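(* Let $P\subset\mathbb{R}^m$, $\bar p\in P$, $F:\mathbb{R}^m\times\mathbb{R}^n\to\mathbb{R}^n$ continuously differentiable, and $\varphi=(\varphi_1,\dots,\varphi_{l_I}):\mathbb{R}^m\times\mathbb{R}^n\to\mathbb{R}^{l_I}$ of class $\mathcal C^2$. Set $G(p,x,y):=F(p,x)+\nabla_x\varphi(p,x)^Ty$, $g(p,x,y):=(G(p,x,y),(\varphi(p,x),y))$, $C:=\{0_{\mathbb{R}^n}\}\times\operatorname{gph}N_{\mathbb{R}^{l_I}_-}$, and $\Gamma(p):=\{(x,y)\in\mathbb{R}^n\times\mathbb{R}^{l_I}: g(p,x,y)\in C\}$ for $p\in P$. Let $(\bar x,\bar y)\in\Gamma(\bar p)$. Suppose that for every $w\in T_P(\bar p)$ there is $(u,v)\in\mathbb{R}^n\times\mathbb{R}^{l_I}$ with $$(\ast)\quad \nabla_pG(\bar p,\bar x,\bar y)w+\nabla_xG(\bar p,\bar x,\bar y)u+\nabla_x\varphi(\bar p,\bar x)^Tv=0,\quad (\nabla\varphi(\bar p,\bar x)(w,u),v)\in T_{\operatorname{gph}N_{\mathbb{R}^{l_I}_-}}((\varphi(\bar p,\bar x),\bar y)),$$ and that for every $(w,u,v)\ne(0,0,0)$ with $w\in T_P(\bar p)$ satisfying $(\ast)$ and every $(z,\lambda,d)\in\mathbb{R}^n\times\mathbb{R}^{l_I}\times\mathbb{R}^{l_I}$ the conditions $\nabla_xG(\bar p,\bar x,\bar y)^Tz+\nabla_x\varphi(\bar p,\bar x)^T\lambda=0$,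 $\nabla_x\varphi(\bar p,\bar x)z+d=0$, $(\lambda,d)\in N_{\operatorname{gph}N_{\mathbb{R}^{l_I}_-}}\big((\varphi(\bar p,\bar x),\bar y);(\nabla\varphi(\bar p,\bar x)(w,u),v)\big)$ imply $(z,\lambda)=(0,0)$. Then the system $g(p,x,y)\in C$, $p\in P$, enjoys Robinson stability at $(\bar p,(\bar x,\bar y))$, and $\Gamma$ is Lipschitz-like around $(\bar p,(\bar x,\bar y))$.
   Context: $\operatorname{gph}N_{\mathbb{R}^{l_I}_-}=\{(a,y)\in\mathbb{R}^{l_I}\times\mathbb{R}^{l_I}: a\le0,\ y\ge0,\ a_iy_i=0\ \forall i\}$ (graph of the normal cone mapping of the nonpositive orthant). $\nabla\varphi(\bar p,\bar x)(w,u)=\nabla_p\varphi(\bar p,\bar x)w+\nabla_x\varphi(\bar p,\bar x)u$. $T$ is the contingent cone; $N_\Omega(\bar z;w)=\{v:\exists t_k\downarrow0,w_k\to w,v_k\to v,\ \bar z+t_kw_k\in\Omega,\ v_k\in\widehat N_\Omega(\bar z+t_kw_k)\}$ the directional limiting normal cone ($\widehat N$ regular normal cone). Robinson stability at $(\bar p,\bar\xi)$ for $g(p,\xi)\in C$: there exist $\kappa\ge0$ and neighborhoods $V$ of $\bar p$ in $P$, $U$ of $\bar\xi$ with $\operatorname{dist}(\xi;\Gamma(p))\le\kappa\operatorname{dist}(g(p,\xi);C)$ for $(p,\xi)\in V\times U$. Lipschitz-like: there exist $\ell\ge0$ and neighborhoods $V$ of $\bar p$ in $P$, $U$ of $(\bar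 x,\bar y)$ with $\Gamma(p)\cap U\subset\Gamma(p')+\ell\|p-p'\|\mathbb{B}$ for all $p,p'\in V$. *)

(* Defs.v *)
From Stdlib Require Import Reals.
From mathcomp Require Import ssreflect ssrfun ssrbool eqtype ssrnat seq fintype bigop.
Set Implicit Arguments. Unset Strict Implicit.
Open Scope R_scope.

Definition vec (k : nat) := 'I_k -> R.
Definition mat (a b : nat) := 'I_a -> 'I_b -> R.

Definition vzero {k} : vec k := fun _ => 0.
Definition vadd {k} (u v : vec k) : vec k := fun i => u i + v i.
Definition vsub {k} (u v : vec k) : vec k := fun i => u i - v i.
Definition vscal {k} (t : R) (u : vec k) : vec k := fun i => t * u i.
Definition dot {k} (u v : vec k) : R := \big[Rplus/0]_(i < k) (u i * v i).
Definition vnorm {k} (u : vec k) : R := sqrt (dot u u).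
Definition norm2 {a b} (u : vec a) (v : vec b) : R := sqrt (dot u u + dot v v).
Definition norm3 {a b c} (u : vec a) (v : vec b) (w : vec c) : R :=
  sqrt (dot u u + dot v v + dot w w).

Definition mv {a b} (A : mat a b) (v : vec b) : vec a := fun i => dot (A i) v.
Definition mtv {a b} (A : mat a b) (v : vec a) : vec b :=
  fun j => \big[Rplus/0]_(i < a) (A i j * v i).

Definition sdiff {m n} (h : vec m -> vec n -> R) (p : vec m) (x : vec n)
  (gp : vec m) (gx : vec n) : Prop :=
  forall eps, 0 < eps -> exists delta, 0 < delta /\
    forall hp hx, norm2 hp hx < delta ->
      Rabs (h (vadd p hp) (vadd x hx) - h p x - dot gp hp - dot gx hx)
        <= eps * norm2 hp hx.

Definition cont2 {m n} (h : vec m -> vec n -> R) : Prop :=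
  forall p x eps, 0 < eps -> exists delta, 0 < delta /\
    forall p' x', norm2 (vsub p' p) (vsub x' x) < delta ->
      Rabs (h p' x' - h p x) < eps.

Definition C1s {m n} (h : vec m -> vec n -> R) : Prop :=
  exists (gp : vec m -> vec n -> vec m) (gx : vec m -> vec n -> vec n),
    (forall p x, sdiff h p x (gp p x) (gx p x)) /\
    (forall j, cont2 (fun p x => gp p x j)) /\
    (forall j, cont2 (fun p x => gx p x j)).

Definition vconv {k} (wk : nat -> vec k) (w : vec k) : Prop :=
  Un_cv (fun j => vnorm (vsub (wk j) w)) 0.

Definition pos_to_zero (t : nat -> R) : Prop :=
  (forall j, 0 < t j) /\ Un_cv t 0.

Definition tangent {k} (S : vec k -> Prop) (z w : vec k) : Prop :=
  exists (t : nat -> R) (wk : nat -> vec k),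
    pos_to_zero t /\ vconv wk w /\ forall j, S (vadd z (vscal (t j) (wk j))).

Definition tangent2 {a b} (Q : vec a -> vec b -> Prop) (z1 : vec a) (z2 : vec b)
  (w1 : vec a) (w2 : vec b) : Prop :=
  exists (t : nat -> R) (w1k : nat -> vec a) (w2k : nat -> vec b),
    pos_to_zero t /\ vconv w1k w1 /\ vconv w2k w2 /\
    forall j, Q (vadd z1 (vscal (t j) (w1k j))) (vadd z2 (vscal (t j) (w2k j))).

Definition rnormal2 {a b} (Q : vec a -> vec b -> Prop) (z1 : vec a) (z2 : vec b)
  (v1 : vec a) (v2 : vec b) : Prop :=
  Q z1 z2 /\
  forall eps, 0 < eps -> exists delta, 0 < delta /\
    forall y1 y2, Q y1 y2 -> norm2 (vsub y1 z1) (vsub y2 z2) < delta ->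
      dot v1 (vsub y1 z1) + dot v2 (vsub y2 z2)
        <= eps * norm2 (vsub y1 z1) (vsub y2 z2).

Definition dnormal2 {a b} (Q : vec a -> vec b -> Prop) (z1 : vec a) (z2 : vec b)
  (w1 : vec a) (w2 : vec b) (v1 : vec a) (v2 : vec b) : Prop :=
  exists (t : nat -> R) (w1k : nat -> vec a) (w2k : nat -> vec b)
         (v1k : nat -> vec a) (v2k : nat -> vec b),
    pos_to_zero t /\ vconv w1k w1 /\ vconv w2k w2 /\
    vconv v1k v1 /\ vconv v2k v2 /\
    forall j, Q (vadd z1 (vscal (t j) (w1k j))) (vadd z2 (vscal (t j) (w2k j))) /\
              rnormal2 Q (vadd z1 (vscal (t j) (w1k j))) (vadd z2 (vscal (t j) (w2k j)))
                         (v1k j) (v2k j).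

Definition gphN {l} (a y : vec l) : Prop :=
  forall i, a i <= 0 /\ 0 <= y i /\ a i * y i = 0.

(* Main.v *)
(** Write [q = (x, y)] and [g(p, q) = (G, (phi, y))], and call [(p, q, c)]
[eta]-stationary when [c] is a point of [C] nearest to [g(p, q)], the residual
[|g(p, q) - c|] is positive but at most [eta] times the distance [t] from
[(p, q)] to the base point, [t < eta], and [q] locally minimises
[|g(p, .) - c| + eta |. - q|]. If such triples existed for every [eta], rescaling
by [t] and passing to a limit would give a nonzero critical direction and a unit
multiplier violating the second hypothesis; so there are none for some [eta].
Minimising [|g(p, q') - c'| + eta |q' - q|] over a ball (a finite-dimensional
Ekeland principle) therefore reaches a solution as soon as the residual at [q] is
small compared with [t]. Started at the first-order prediction supplied by the
first hypothesis, this yields a point of [Gamma(p)] at distance [O(|p - pb|)] from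
the base point; that point serves when the residual is not small compared
with [t]. *)
Require Import Defs.
From Stdlib Require Import Reals Lra Lia FunctionalExtensionality Classical ClassicalEpsilon.
From HB Require Import structures.
From mathcomp Require Import ssreflect ssrfun ssrbool eqtype ssrnat seq fintype bigop.
Set Implicit Arguments. Unset Strict Implicit. Unset Printing Implicit Defensive.
Open Scope R_scope.

(** The obstacle is that the multiplier condition is only directional: it gives no control over
    normals of [C] at points approached along other directions. The bound of the residual by
    [eta * t] is what compensates. It makes [(c - g(pb, qb)) / t] converge to the derivative of [g]
    along the limit direction, so the normals at [c] become directional normals along a critical
    direction. Its price is that descent is available only where the residual is small relative to
    [t], which is why solutions at distance O(|p - pb|) have to be produced separately. The
    stability argument is run for a general closed [C] and a map [g] known only to be strictly
    differentiable at the base point; one pair of matrices then serves as approximate derivative at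
    all nearby points. The shape of the complementarity set enters through its closedness and
    through the fact that its tangent directions can be followed exactly for a short time, so that
    the first-order prediction misses [C] by only o(t). *)

Lemma RplusA : associative Rplus.
Proof. by move=> x y z; lra. Qed.
Lemma RplusC : commutative Rplus.
Proof. by move=> x y; lra. Qed.
Lemma Rplus0l : left_id 0 Rplus.
Proof. by move=> x; lra. Qed.
HB.instance Definition _ :=
  Monoid.isComLaw.Build R 0 Rplus RplusA RplusC Rplus0l.

(** * Finite sums and Euclidean norms over a finite index type *)

Section Sums.
Variable I : finType.
Implicit Types f g : I -> R.

Lemma rsum_add f g :
  \big[Rplus/0]_i (f i + g i) = \big[Rplus/0]_i f i + \big[Rplus/0]_i g i.
Proof. exact: big_split. Qed.

Lemma rsum_scal t f : \big[Rplus/0]_i (t * f i) = t * \big[Rplus/0]_i f i.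
Proof. by apply: (big_rec2 (fun x y => x = t * y)) => [|i x y _ ->]; lra. Qed.

Lemma rsum_le f g : (forall i, f i <= g i) ->
  \big[Rplus/0]_i f i <= \big[Rplus/0]_i g i.
Proof.
move=> H; apply: (big_rec2 (fun x y => x <= y)) => [|i x y _]; first lra.
by move: (H i); lra.
Qed.

Lemma rsum_ge0 f : (forall i, 0 <= f i) -> 0 <= \big[Rplus/0]_i f i.
Proof.
move=> H; apply: (big_ind (fun x => 0 <= x)) => [|x y|i _]; [lra|lra|exact: H].
Qed.

Lemma rsum_const c : \big[Rplus/0]_(i : I) c = INR #|I| * c.
Proof.
rewrite big_const; elim: #|I| => [|k IH]; first by rewrite /=; lra.
by rewrite iterS IH S_INR; lra.
Qed.

Lemma rsum_term f i : (forall j, 0 <= f j) -> f i <= \big[Rplus/0]_j f j.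
Proof.
move=> H; rewrite (bigD1 i) //=.
suff : 0 <= \big[Rplus/0]_(j | j != i) f j by lra.
by apply: (big_ind (fun x => 0 <= x)) => [|x y|j _]; [lra|lra|exact: H].
Qed.

Lemma rsum_pick f i : (forall j, j != i -> f j = 0) -> \big[Rplus/0]_j f j = f i.
Proof.
move=> H; rewrite (bigD1 i) //= big1 //; first lra.
Qed.

End Sums.

Section Euclid.
Variable I : finType.
Implicit Types u v w : I -> R.

Definition edot u v : R := \big[Rplus/0]_i (u i * v i).
Definition enorm u : R := sqrt (edot u u).
Definition edist u v : R := enorm (fun i => u i - v i).

Lemma edotC u v : edot u v = edot v u.
Proof. by apply: eq_bigr => i _; lra. Qed.

Lemma edot_lin u v w s t :
  edot w (fun i => s * u i + t * v i) = s * edot w u + t * edot w v.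
Proof.
by rewrite /edot -!rsum_scal -rsum_add; apply: eq_bigr => i _; lra.
Qed.

Lemma edot_lin_sq u v s t :
  edot (fun i => s * u i + t * v i) (fun i => s * u i + t * v i) =
  s * s * edot u u + 2 * (s * t) * edot u v + t * t * edot v v.
Proof.
rewrite edot_lin ![edot (fun i => _ + _) _]edotC !edot_lin (edotC v u); lra.
Qed.

Lemma edot_ge0 u : 0 <= edot u u.
Proof. by apply: rsum_ge0 => i; nra. Qed.

Lemma enorm_ge0 u : 0 <= enorm u.
Proof. exact: sqrt_pos. Qed.

Lemma enorm_sq u : enorm u * enorm u = edot u u.
Proof. exact/sqrt_sqrt/edot_ge0. Qed.

Lemma coord_le u i : Rabs (u i) <= enorm u.
Proof.
rewrite -sqrt_Rsqr_abs; apply: sqrt_le_1_alt.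
by apply: (rsum_term (f := fun i => u i * u i)) => j; nra.
Qed.

Lemma enorm_eq0 u : enorm u = 0 -> forall i, u i = 0.
Proof.
move=> H i; move: (coord_le u i) (Rabs_pos (u i)); rewrite H => ? ?.
by case: (Req_dec (u i) 0) => // /Rabs_no_R0; lra.
Qed.

Lemma edot0l u v : (forall i, u i = 0) -> edot u v = 0.
Proof. by move=> H; rewrite /edot big1 // => i _; rewrite H; lra. Qed.

Lemma enorm_zero u : (forall i, u i = 0) -> enorm u = 0.
Proof. by move=> H; rewrite /enorm edot0l // sqrt_0. Qed.

Lemma edot_le u v : edot u v <= enorm u * enorm v.
Proof.
have Hu := enorm_ge0 u; have Hv := enorm_ge0 v.
case: (Req_dec (enorm u) 0) => [u0|u0].
  by rewrite edot0l ?u0; [lra|exact: enorm_eq0].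
case: (Req_dec (enorm v) 0) => [v0|v0].
  by rewrite edotC edot0l ?v0; [lra|exact: enorm_eq0].
(* The square of |v|u - |u|v expands to 2|u||v|(|u||v| - u.v); cancelling the positive factor gives
   the bound, which is why zero norms were split off. *)
have := edot_ge0 (fun i => enorm v * u i + - enorm u * v i).
rewrite edot_lin_sq -!enorm_sq => H.
have Hp : 0 < enorm u * enorm v by apply: Rmult_lt_0_compat; lra.
apply: (Rmult_le_reg_l (2 * (enorm u * enorm v))); first lra.
nra.
Qed.

Lemma edot_abs u v : Rabs (edot u v) <= enorm u * enorm v.
Proof.
apply: Rabs_le; split; last exact: edot_le.
have := edot_le (fun i => - u i) v.
have -> : enorm (fun i => - u i) = enorm u.
  by rewrite /enorm; congr sqrt; apply: eq_bigr => i _; lra.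
have -> : edot (fun i => - u i) v = - edot u v.
  by rewrite /edot -[RHS]Rmult_1_l Ropp_mult_distr_r_reverse Ropp_mult_distr_l
    -rsum_scal; apply: eq_bigr => i _; lra.
lra.
Qed.

Lemma enorm_ext u v : (forall i, u i = v i) -> enorm u = enorm v.
Proof. by move=> H; congr enorm; apply: functional_extensionality. Qed.

Lemma enorm_add u v : enorm (fun i => u i + v i) <= enorm u + enorm v.
Proof.
have Hu := enorm_ge0 u; have Hv := enorm_ge0 v.
apply: Rsqr_incr_0_var; last lra.
rewrite /Rsqr enorm_sq.
have := edot_lin_sq u v 1 1.
have -> : (fun i => 1 * u i + 1 * v i) = (fun i => u i + v i).
  by apply: functional_extensionality => i; lra.
move=> ->; rewrite -!enorm_sq; have := edot_le u v; nra.
Qed.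

Lemma enorm_scal t u : enorm (fun i => t * u i) = Rabs t * enorm u.
Proof.
rewrite /enorm -sqrt_Rsqr_abs -sqrt_mult; [|exact: Rle_0_sqr|exact: edot_ge0].
by congr sqrt; rewrite /edot -rsum_scal; apply: eq_bigr => i _; rewrite /Rsqr; lra.
Qed.

Lemma enorm_sub u v : enorm (fun i => u i - v i) <= enorm u + enorm v.
Proof.
have := enorm_add u (fun i => -1 * v i); rewrite enorm_scal Rabs_Ropp Rabs_R1 Rmult_1_l.
by rewrite (@enorm_ext _ (fun i => u i - v i)) // => i; lra.
Qed.

(** A crude factor: the sum of squares gives the square root of [#|I|], and n <= n * n for naturals
    permits [#|I|] itself. *)
Lemma enorm_bound u M : 0 <= M -> (forall i, Rabs (u i) <= M) -> enorm u <= INR #|I| * M.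
Proof.
move=> M0 H; have Hn := pos_INR #|I|.
have Hn1 : INR #|I| <= INR #|I| * INR #|I|.
  by rewrite -mult_INR; apply: le_INR; move: #|I| => [|k]; lia.
apply: Rsqr_incr_0_var; last nra.
rewrite /Rsqr enorm_sq.
have : edot u u <= INR #|I| * (M * M).
  rewrite -rsum_const; apply: rsum_le => i.
  by have := H i; rewrite /Rabs; case: Rcase_abs => ? ?; nra.
nra.
Qed.

Lemma edist_ge0 u v : 0 <= edist u v. Proof. exact: enorm_ge0. Qed.

Lemma edist_refl u : edist u u = 0.
Proof. by apply: enorm_zero => i; lra. Qed.

Lemma edist_sym u v : edist u v = edist v u.
Proof. by rewrite /edist /enorm; congr sqrt; apply: eq_bigr => i _; lra. Qed.

Lemma edist_tri v u w : edist u w <= edist u v + edist v w.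
Proof.
apply: Rle_trans (enorm_add _ _); apply: Req_le; apply: enorm_ext => i /=; lra.
Qed.

Lemma edist_eq0 u v : edist u v = 0 -> u = v.
Proof.
move=> /enorm_eq0 H; apply: functional_extensionality => i; have := H i; lra.
Qed.

End Euclid.

Lemma matrix_bound (K J : finType) (B : K -> J -> R) :
  exists M, 0 <= M /\ forall h, enorm (fun k => edot (B k) h) <= M * enorm h.
Proof.
set S := \big[Rplus/0]_k enorm (B k).
have S0 : 0 <= S by apply: rsum_ge0 => k; exact: enorm_ge0.
exists (INR #|K| * S); split; first by apply: Rmult_le_pos => //; exact: pos_INR.
move=> h; have Hh := enorm_ge0 h.
rewrite Rmult_assoc; apply: enorm_bound => [|k]; first nra.
apply: Rle_trans (edot_abs _ _) _; apply: Rmult_le_compat_r => //.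
by apply: (rsum_term (f := fun k => enorm (B k))) => j; exact: enorm_ge0.
Qed.

(** * Convergence, eventual properties and compactness *)

Section Sequences.

Definition econv (I : finType) (x : nat -> I -> R) (l : I -> R) : Prop :=
  Un_cv (fun k => edist (x k) l) 0.

Definition ev (Q : nat -> Prop) : Prop := exists N, forall k, (N <= k)%coq_nat -> Q k.

Lemma ev_and (Q1 Q2 : nat -> Prop) : ev Q1 -> ev Q2 -> ev (fun k => Q1 k /\ Q2 k).
Proof.
move=> [N1 H1] [N2 H2]; exists (N1 + N2)%nat => k Hk; rewrite /addn /= in Hk.
by split; [apply: H1|apply: H2]; lia.
Qed.

Lemma ev_ex (Q : nat -> Prop) : ev Q -> exists k, Q k.
Proof. by move=> [N H]; exists N; apply: H; lia. Qed.

Lemma ev_imp (Q1 Q2 : nat -> Prop) : (forall k, Q1 k -> Q2 k) -> ev Q1 -> ev Q2.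
Proof. by move=> H [N HN]; exists N => k /HN; exact: H. Qed.

Lemma cv_ev u l eps : Un_cv u l -> 0 < eps -> ev (fun k => Rabs (u k - l) < eps).
Proof. by move=> H /H [N HN]; exists N => k Hk; exact: HN. Qed.

Lemma ev_cv u l : (forall eps, 0 < eps -> ev (fun k => Rabs (u k - l) < eps)) -> Un_cv u l.
Proof. by move=> H eps /H [N HN]; exists N => k Hk; exact: HN. Qed.

Lemma econv_ev (I : finType) (x : nat -> I -> R) l eps :
  econv x l -> 0 < eps -> ev (fun k => edist (x k) l < eps).
Proof.
move=> H e0; apply: ev_imp (cv_ev H e0) => k.
by rewrite Rminus_0_r Rabs_pos_eq //; exact: edist_ge0.
Qed.

Lemma ev_econv (I : finType) (x : nat -> I -> R) l :
  (forall eps, 0 < eps -> ev (fun k => edist (x k) l < eps)) -> econv x l.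
Proof.
move=> H; apply: ev_cv => eps /H; apply: ev_imp => k.
by rewrite Rminus_0_r Rabs_pos_eq //; exact: edist_ge0.
Qed.

Lemma econv_coord (I : finType) (x : nat -> I -> R) l i :
  econv x l -> Un_cv (fun k => x k i) (l i).
Proof.
move=> H; apply: ev_cv => eps e0; apply: ev_imp (econv_ev H e0) => k.
exact: Rle_lt_trans (coord_le (fun i => x k i - l i) i).
Qed.

Lemma ev_all (I : finType) (Q : I -> nat -> Prop) :
  (forall i, ev (Q i)) -> ev (fun k => forall i, Q i k).
Proof.
move=> H.
have : ev (fun k => forall i, i \in enum I -> Q i k).
  elim: (enum I) => [|j s IH]; first by exists O.
  apply: ev_imp (ev_and (H j) IH) => k [Hj Hs] i.
  by rewrite in_cons => /orP [/eqP ->|/Hs].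
by apply: ev_imp => k Hk i; apply: Hk; rewrite mem_enum.
Qed.

Lemma coord_econv (I : finType) (x : nat -> I -> R) l :
  (forall i, Un_cv (fun k => x k i) (l i)) -> econv x l.
Proof.
move=> H; apply: ev_econv => eps e0.
have HN := pos_INR #|I|.
have e1 : 0 < eps / (INR #|I| + 1) by apply: Rdiv_lt_0_compat; lra.
have := ev_all (fun i => cv_ev (H i) e1).
apply: ev_imp => k Hk; apply: Rle_lt_trans.
  by apply: (@enorm_bound _ _ (eps / (INR #|I| + 1))) => [|i]; [lra|apply: Rlt_le; exact: Hk].
have -> : INR #|I| * (eps / (INR #|I| + 1)) = eps - eps / (INR #|I| + 1) by field; lra.
lra.
Qed.

Lemma cv_sub u l (s : nat -> nat) : (forall k, (k <= s k)%coq_nat) ->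
  Un_cv u l -> Un_cv (fun k => u (s k)) l.
Proof.
move=> Hs H eps /H [N HN]; exists N => k Hk; apply: HN; have := Hs k; lia.
Qed.

Lemma inv_small eps : 0 < eps -> ev (fun k => / (INR k + 1) < eps).
Proof.
move=> e0; have [N [HN N0]] := archimed_cor1 eps e0.
exists N => k Hk; apply: Rle_lt_trans HN.
apply: Rinv_le_contravar; first exact: lt_0_INR.
have := le_INR _ _ Hk; lra.
Qed.

(** An adherence value [l] is met beyond every index [k] within 1/(k+1). The selection [s] need not
    be increasing: [k <= s k] is all that [cv_sub] asks. *)
Lemma bolzano1 (u : nat -> R) M : (forall k, Rabs (u k) <= M) ->
  exists (s : nat -> nat) l, (forall k, (k <= s k)%coq_nat) /\ Un_cv (fun k => u (s k)) l.
Proof.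
move=> HM.
have [|l Hl] := @Bolzano_Weierstrass u (fun x => - M <= x <= M) (compact_P3 _ _).
  by move=> k; have := HM k; rewrite /Rabs; case: Rcase_abs => ? ?; lra.
have Hk k : exists p, (k <= p)%coq_nat /\ Rabs (u p - l) < / (INR k + 1).
  have Hp : 0 < / (INR k + 1) by apply: Rinv_0_lt_compat; have := pos_INR k; lra.
  by apply: (Hl (fun x => Rabs (x - l) < / (INR k + 1))); exists (mkposreal _ Hp).
exists (fun k => proj1_sig (constructive_indefinite_description _ (Hk k))), l.
split=> [k|]; first by case: constructive_indefinite_description => p [].
apply: ev_cv => eps /inv_small; apply: ev_imp => k.
by case: constructive_indefinite_description => p [] /=; lra.
Qed.

(** Subsequences are refined one coordinate at a time; limits already obtained survive by
    [cv_sub]. *)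
Lemma bolzano (I : finType) (x : nat -> I -> R) M : (forall k i, Rabs (x k i) <= M) ->
  exists (s : nat -> nat) l, (forall k, (k <= s k)%coq_nat) /\ econv (fun k => x (s k)) l.
Proof.
move=> HM.
suff [s [l [Hs Hl]]] : exists (s : nat -> nat) l, (forall k, (k <= s k)%coq_nat) /\
    forall i, i \in enum I -> Un_cv (fun k => x (s k) i) (l i).
  by exists s, l; split=> //; apply: coord_econv => i; apply: Hl; rewrite mem_enum.
elim: (enum I) => [|j e [s [l [Hs Hl]]]].
  by exists id, (fun=> 0); split=> // k; lia.
have [t [a [Ht Ha]]] := @bolzano1 (fun k => x (s k) j) M (fun k => HM (s k) j).
exists (fun k => s (t k)), (fun i => if i == j then a else l i); split=> [k|i].
  by have := Ht k; have := Hs (t k); lia.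
rewrite in_cons; case: eqP => [-> //|_ /= /Hl]; exact: cv_sub.
Qed.

End Sequences.

Lemma edot_scalr (I : finType) (u v : I -> R) t :
  edot u (fun i => t * v i) = t * edot u v.
Proof. by rewrite /edot -rsum_scal; apply: eq_bigr => i _; lra. Qed.

Lemma edot_scall (I : finType) (u v : I -> R) t :
  edot (fun i => t * u i) v = t * edot u v.
Proof. by rewrite edotC edot_scalr edotC. Qed.

Lemma edot_subr (I : finType) (a u v : I -> R) :
  edot a (fun i => u i - v i) = edot a u - edot a v.
Proof.
have -> : (fun i => u i - v i) = (fun i => 1 * u i + -1 * v i).
  by apply: functional_extensionality => i; lra.
rewrite edot_lin; lra.
Qed.

(** Selects step sizes and radii throughout; dividing by [b + 1] covers [b = 0]. *)
Lemma small_mult c b : 0 < c -> 0 <= b ->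
  exists s0, 0 < s0 /\ forall s, 0 <= s <= s0 -> s * b < c.
Proof.
move=> c0 b0; exists (c / (b + 1)).
have s0 : 0 < c / (b + 1) by apply: Rdiv_lt_0_compat; lra.
split=> // s Hs; apply: (@Rle_lt_trans _ (c / (b + 1) * b)); first nra.
have -> : c / (b + 1) * b = c - c / (b + 1) by field; lra.
lra.
Qed.

(** * Tangents, regular normals and directional limiting normals *)

Section Directional.
Variables I : finType.
Implicit Types (S : (I -> R) -> Prop) (z w v : I -> R).

(** The cones of the statement are restated over an arbitrary finite index type, so that products of
    spaces become sum types instead of arithmetic on ordinals. *)
Definition etangent S z w : Prop :=
  exists (t : nat -> R) (wk : nat -> I -> R),
    pos_to_zero t /\ econv wk w /\ forall j, S (fun i => z i + t j * wk j i).

Definition enormal S z v : Prop :=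
  S z /\ forall eps, 0 < eps -> exists delta, 0 < delta /\
    forall y, S y -> edist y z < delta ->
      edot v (fun i => y i - z i) <= eps * edist y z.

Definition ednormal S z w v : Prop :=
  exists (t : nat -> R) (wk vk : nat -> I -> R),
    pos_to_zero t /\ econv wk w /\ econv vk v /\
    forall j, enormal S (fun i => z i + t j * wk j i) (vk j).

Definition eclosed S : Prop :=
  forall (x : nat -> I -> R) l, (forall k, S (x k)) -> econv x l -> S l.

(** Expanding |x - z|^2 <= |x - y|^2 gives <x - z, y - z> <= |y - z|^2 / 2. This quadratic bound,
    divided by E = |x - z|, is below eps |y - z| once |y - z| < 2 E eps. *)
Lemma proximal_normal S z x : S z -> 0 < edist x z ->
  (forall y, S y -> edist x z <= edist x y) ->
  enormal S z (fun i => / edist x z * (x i - z i)).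
Proof.
move=> Sz E0 Hmin; split=> // eps e0; set E := edist x z in E0 Hmin *.
exists (2 * E * eps); split=> [|y Sy Hy]; first nra.
rewrite edot_scall.
have HE : E * E = edot (fun i => x i - z i) (fun i => x i - z i) by exact: enorm_sq.
have HY : edist y z * edist y z = edot (fun i => y i - z i) (fun i => y i - z i).
  exact: enorm_sq.
have := edot_lin_sq (fun i => x i - z i) (fun i => y i - z i) 1 (-1).
have -> : (fun i => 1 * (x i - z i) + -1 * (y i - z i)) = (fun i => x i - y i).
  by apply: functional_extensionality => i; lra.
rewrite -HE -HY -enorm_sq -/(edist x y).
have H1 := Hmin _ Sy; have H2 := edist_ge0 y z.
set X := edot _ _ => HH.
apply: (Rmult_le_reg_l E) => //; rewrite -Rmult_assoc Rinv_r; last lra.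
nra.
Qed.

End Directional.

Lemma approx_inf (T : Type) (D : T -> Prop) (f : T -> R) x0 :
  D x0 -> (forall x, D x -> 0 <= f x) ->
  exists m, (forall x, D x -> m <= f x) /\
    forall eps, 0 < eps -> exists x, D x /\ f x < m + eps.
Proof.
move=> D0 f0.
have [||m [ub lub]] := completeness (fun y => exists x, D x /\ y = - f x).
- by exists 0 => y [x [/f0 ? ->]]; lra.
- by exists (- f x0), x0.
exists (- m); split=> [x Dx|eps e0].
  by have := ub (- f x) (ex_intro _ x (conj Dx erefl)); lra.
apply: NNPP => H; have : m <= m - eps; last lra.
apply: lub => y [x [Dx ->]]; apply: Rnot_lt_le => Hx; apply: H; exists x; split=> //; lra.
Qed.

(** * Stability of an abstract system [C (g p q)] *)

Section Robinson.
Variables (I J K : finType) (P : (I -> R) -> Prop) (pb : I -> R) (qb : J -> R).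
Variables (g : (I -> R) -> (J -> R) -> K -> R) (C : (K -> R) -> Prop).
Variables (A : K -> I -> R) (B : K -> J -> R).

(** The two-point form matters: stationary points lie near the base point rather than at it, and
    [A], [B] must describe increments of [g] from there. *)
Definition strict_diff : Prop := forall eps, 0 < eps -> exists delta, 0 < delta /\
  forall p p' q q', edist p pb < delta -> edist p' pb < delta ->
    edist q qb < delta -> edist q' qb < delta ->
    enorm (fun k => g p' q' k - g p q k -
       (edot (A k) (fun i => p' i - p i) + edot (B k) (fun j => q' j - q j)))
      <= eps * (edist p' p + edist q' q).

Definition dirder w h k := edot (A k) w + edot (B k) h.

Hypothesis gdiff : strict_diff.

Definition stationary eta p q c : Prop :=
  [/\ P p, C c, edist p pb + edist q qb < eta &
   [/\ 0 < edist (g p q) c,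
       edist (g p q) c <= eta * (edist p pb + edist q qb),
       forall c', C c' -> edist (g p q) c <= edist (g p q) c' &
       exists rho, 0 < rho /\ forall q', edist q' q < rho ->
         edist (g p q) c <= edist (g p q') c + eta * edist q' q]].

(** The unit residual is almost orthogonal to the range of [B]: otherwise a short move of [q] along
    [h] would lower the residual faster than the penalty with slope [eta] and the linearisation
    error with slope [eps] can offset. *)
Lemma fermat eps : 0 < eps -> exists delta, 0 < delta /\
  forall eta p q c, 0 < eta -> stationary eta p q c ->
    edist p pb + edist q qb < delta -> forall h,
    - (eta + eps) * enorm h <=
    edot (fun k => / edist (g p q) c * (g p q k - c k)) (fun k => edot (B k) h).
Proof.
move=> eps0; have [delta [d0 Hd]] := gdiff eps0; exists delta; split=> //.
move=> eta p q c eta0 [_ _ _ [E0 _ _ [rho [rho0 Hrho]]]] Hpq h.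
have Hp0 := edist_ge0 p pb; have Hq0 := edist_ge0 q qb.
rewrite edot_scall; set E := edist _ _ in E0 Hrho *.
set X := edot _ _; apply: (Rmult_le_reg_l E) => //.
rewrite -[E * (/ E * X)]Rmult_assoc Rinv_r; last lra.
rewrite Rmult_1_l; apply: Rnot_lt_le => HX.
have Hh := enorm_ge0 h; set a := (eta + eps) * enorm h.
have HX' : 0 < 2 * (- (E * a) - X) by rewrite /a; lra.
set N := enorm (fun k => edot (B k) h).
have a0 : 0 <= a by apply: Rmult_le_pos => //; lra.
(* Four bounds on the step [s]: [s1] keeps [q'] where the linearisation holds, [s2] inside the ball
   of local minimality, [s3] keeps [E - s * a] positive so that it may be squared, and [s4] makes
   the second-order term smaller than the assumed first-order gain. *)
have [||s1 [s10 H1]] := @small_mult (delta - edist q qb) (enorm h); [lra|lra|].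
have [||s2 [s20 H2]] := @small_mult rho (enorm h); [lra|lra|].
have [||s3 [s30 H3]] := @small_mult E a; [lra|lra|].
have [||s4 [s40 H4]] := @small_mult (2 * (- (E * a) - X)) (N * N); [lra|nra|].
have [s [s0 [Hs1 [Hs2 [Hs3 Hs4]]]]] : exists s, 0 < s /\ s <= s1 /\ s <= s2 /\ s <= s3 /\ s <= s4.
  exists (Rmin (Rmin s1 s2) (Rmin s3 s4)).
  have := Rmin_l (Rmin s1 s2) (Rmin s3 s4); have := Rmin_r (Rmin s1 s2) (Rmin s3 s4).
  have := Rmin_l s1 s2; have := Rmin_r s1 s2; have := Rmin_l s3 s4; have := Rmin_r s3 s4.
  move=> *; repeat split; try lra.
  by do 3?apply: Rmin_glb_lt.
have {}H1 := H1 s (conj (Rlt_le _ _ s0) Hs1).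
have {}H2 := H2 s (conj (Rlt_le _ _ s0) Hs2).
have {}H3 := H3 s (conj (Rlt_le _ _ s0) Hs3).
have {}H4 := H4 s (conj (Rlt_le _ _ s0) Hs4).
set q' := fun j => q j + s * h j.
have Hqq : edist q' q = s * enorm h.
  rewrite -[s in RHS]Rabs_pos_eq -?enorm_scal; last lra.
  by apply: enorm_ext => j; rewrite /q'; lra.
have Hq' : edist q' qb < delta by have := edist_tri q q' qb; lra.
have Hq : edist q qb < delta by lra.
have Hp : edist p pb < delta by lra.
have := Hd p p q q' Hp Hp Hq Hq'; rewrite edist_refl Hqq.
set r := fun k : K => _ => Hr.
have Hlin : edist (g p q') c <= enorm (fun k => 1 * (g p q k - c k) + s * edot (B k) h) + enorm r.
  apply: Rle_trans (enorm_add _ _); apply: Req_le; apply: enorm_ext => k.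
  have -> : r k = g p q' k - g p q k - s * edot (B k) h.
    rewrite /r edotC edot0l => [|i]; last lra.
    have -> : (fun j => q' j - q j) = (fun j => s * h j).
      by apply: functional_extensionality => j; rewrite /q'; lra.
    rewrite edot_scalr; lra.
  lra.
have Hle : E - s * a <= enorm (fun k => 1 * (g p q k - c k) + s * edot (B k) h).
  have := Hrho q'; rewrite Hqq => /(_ H2); rewrite /a; nra.
have : (E - s * a) * (E - s * a) <= E * E + 2 * s * X + s * s * (N * N).
  have -> : E * E + 2 * s * X + s * s * (N * N) =
    enorm (fun k => 1 * (g p q k - c k) + s * edot (B k) h) *
    enorm (fun k => 1 * (g p q k - c k) + s * edot (B k) h).
    rewrite /N /E !enorm_sq edot_lin_sq -/X; lra.
  by apply: Rmult_le_compat; lra.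
nra.
Qed.

Hypothesis Cclosed : eclosed C.
(** Abstract form of the multiplier condition: [v] collects (z, lambda, d), and orthogonality to the
    range of [B] is the adjoint system. *)
Hypothesis regular : forall w h, (exists i, w i <> 0) \/ (exists j, h j <> 0) ->
  etangent P pb w -> etangent C (g pb qb) (dirder w h) ->
  forall v, ednormal C (g pb qb) (dirder w h) v ->
  (forall h', edot v (fun k => edot (B k) h') = 0) -> forall k, v k = 0.

Lemma no_stationary : exists eta, 0 < eta /\ forall p q c, ~ stationary eta p q c.
Proof.
apply: NNPP => Hno.
have inv_pos k : 0 < / (INR k + 1).
  by apply: Rinv_0_lt_compat; have := pos_INR k; lra.
have Hex k : exists x : (I -> R) * (J -> R) * (K -> R),
    stationary (/ (INR k + 1)) x.1.1 x.1.2 x.2.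
  apply: NNPP => Hn; apply: Hno; exists (/ (INR k + 1)); split=> // p q c Hs.
  by apply: Hn; exists (p, q, c).
pose f k := proj1_sig (constructive_indefinite_description _ (Hex k)).
have Hf k : stationary (/ (INR k + 1)) (f k).1.1 (f k).1.2 (f k).2.
  by rewrite /f; case: constructive_indefinite_description.
move: f Hf => f Hf {Hex Hno}.
pose p k := (f k).1.1; pose q k := (f k).1.2; pose c k := (f k).2.
have {}Hf k : stationary (/ (INR k + 1)) (p k) (q k) (c k) := Hf k.
pose t k := edist (p k) pb + edist (q k) qb.
pose E k := edist (g (p k) (q k)) (c k).
have E0 k : 0 < E k by case: (Hf k) => _ _ _ [].
have EE k : E k <= / (INR k + 1) * t k by case: (Hf k) => _ _ _ [].
have t0 k : 0 < t k.
  by have := EE k; have := E0 k; have := inv_pos k; nra.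
pose w k i := / t k * (p k i - pb i).
pose h k j := / t k * (q k j - qb j).
pose v k x := / E k * (g (p k) (q k) x - c k x).
have nw k : enorm (w k) = / t k * edist (p k) pb.
  by rewrite /w enorm_scal Rabs_pos_eq //; apply/Rlt_le/Rinv_0_lt_compat.
have nh k : enorm (h k) = / t k * edist (q k) qb.
  by rewrite /h enorm_scal Rabs_pos_eq //; apply/Rlt_le/Rinv_0_lt_compat.
have nwh k : enorm (w k) + enorm (h k) = 1.
  by rewrite nw nh -Rmult_plus_distr_l Rinv_l //; have := t0 k; rewrite /t; lra.
have nv k : enorm (v k) = 1.
  rewrite /v enorm_scal Rabs_pos_eq; last by apply/Rlt_le/Rinv_0_lt_compat.
  by rewrite Rinv_l //; have := E0 k; rewrite /E; lra.
(* Direction and multiplier are stacked into one vector, so that a single extraction makes all of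
   them converge. *)
pose x k (s : (I + J) + K) := match s with
  inl (inl i) => w k i | inl (inr j) => h k j | inr y => v k y end.
have [] := @bolzano _ x 1.
  move=> k [[i|j]|y] /=.
  - have := coord_le (w k) i; have := nwh k; have := enorm_ge0 (h k); lra.
  - have := coord_le (h k) j; have := nwh k; have := enorm_ge0 (w k); lra.
  - have := coord_le (v k) y; have := nv k; lra.
move=> s [l [Hs Hl]].
pose wl i := l (inl (inl i)); pose hl j := l (inl (inr j)); pose vl y := l (inr y).
have cw : econv (fun k => w (s k)) wl.
  by apply: coord_econv => i; exact: (econv_coord (inl (inl i)) Hl).
have ch : econv (fun k => h (s k)) hl.
  by apply: coord_econv => j; exact: (econv_coord (inl (inr j)) Hl).
have cv : econv (fun k => v (s k)) vl.
  by apply: coord_econv => y; exact: (econv_coord (inr y) Hl).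
have ceta : Un_cv (fun k => / (INR k + 1)) 0.
  apply: ev_cv => eps /inv_small; apply: ev_imp => k.
  by rewrite Rminus_0_r Rabs_pos_eq //; apply: Rlt_le.
have {}ceta := cv_sub Hs ceta.
have teta k : t k < / (INR k + 1) by case: (Hf k).
have ct : Un_cv (fun k => t (s k)) 0.
  apply: ev_cv => eps e0; apply: ev_imp (cv_ev ceta e0) => k.
  rewrite !Rminus_0_r !Rabs_pos_eq; have := t0 (s k); have := teta (s k); lra.
have pt : pos_to_zero (fun k => t (s k)) by split.
have limnz (L : finType) (y : nat -> L -> R) (yl : L -> R) :
    econv y yl -> (forall j, yl j = 0) -> Un_cv (fun k => enorm (y k)) 0.
  move=> Hy H0; apply: ev_cv => eps e0; apply: ev_imp (econv_ev Hy e0) => k.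
  rewrite Rminus_0_r Rabs_pos_eq; last exact: enorm_ge0.
  by rewrite /edist (@enorm_ext _ _ (y k)) // => j; rewrite H0; lra.
have whnz : (exists i, wl i <> 0) \/ (exists j, hl j <> 0).
  apply: NNPP => H.
  have w0 i : wl i = 0 by apply: NNPP => Hi; apply: H; left; exists i.
  have h0 j : hl j = 0 by apply: NNPP => Hj; apply: H; right; exists j.
  have half : 0 < 1 / 2 by lra.
  have [k []] := ev_ex (ev_and (cv_ev (limnz _ _ _ cw w0) half) (cv_ev (limnz _ _ _ ch h0) half)).
  rewrite !Rminus_0_r !Rabs_pos_eq; try exact: enorm_ge0.
  by have := nwh (s k); lra.
have tw : etangent P pb wl.
  exists (fun k => t (s k)), (fun k => w (s k)); split=> //; split=> // k.
  have -> : (fun i => pb i + t (s k) * w (s k) i) = p (s k).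
    apply: functional_extensionality => i; rewrite /w; field.
    by have := t0 (s k); lra.
  by case: (Hf (s k)).
(* [c k] is reached from the base value along [d k] with step [t k]. The same sequence therefore
   witnesses both tangency and the directional normal, provided [d k] tends to [dirder wl hl]. *)
pose d k y := / t k * (c k y - g pb qb y).
have dE k : (fun y => g pb qb y + t k * d k y) = c k.
  apply: functional_extensionality => y; rewrite /d; field.
  by have := t0 k; lra.
have cd : econv (fun k => d (s k)) (dirder wl hl).
  have [MA [MA0 HA]] := matrix_bound A; have [MB [MB0 HB]] := matrix_bound B.
  apply: ev_econv => eps e0; have e4 : 0 < eps / 4 by lra.
  have [dl [dl0 Hdl]] := gdiff e4.
  have [a [a0 Ha]] := small_mult e4 MA0; have [b [b0 Hb]] := small_mult e4 MB0.
  have := ev_and (ev_and (cv_ev ceta e4) (cv_ev ct dl0))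
                 (ev_and (econv_ev cw a0) (econv_ev ch b0)).
  apply: ev_imp => k; move: (s k) => {}k [[]].
  rewrite !Rminus_0_r !Rabs_pos_eq; [|exact: Rlt_le..].
  move=> Heta Ht [Hw Hh].
  have dp := edist_ge0 (p k) pb; have dq := edist_ge0 (q k) qb.
  have Hdiff := Hdl pb (p k) qb (q k); rewrite !edist_refl in Hdiff.
  have {}Hdiff := Hdiff dl0; rewrite -/(t k) in Hdiff.
  have Hp : edist (p k) pb < dl by rewrite /t in Ht; lra.
  have Hq : edist (q k) qb < dl by rewrite /t in Ht; lra.
  have {Hp Hq}Hdiff := Hdiff Hp dl0 Hq.
  set X := (fun y : K => _) in Hdiff.
  have HE := EE k; rewrite /E /edist in HE; set Y := (fun y : K => _) in HE.
  have HA' := HA (fun i => w k i - wl i); have HB' := HB (fun j => h k j - hl j).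
  rewrite -/(edist _ _) in HA'; rewrite -/(edist _ _) in HB'.
  have {}Ha := Ha _ (conj (edist_ge0 _ _) (Rlt_le _ _ Hw)).
  have {}Hb := Hb _ (conj (edist_ge0 _ _) (Rlt_le _ _ Hh)).
  set ZA := (fun y : K => _) in HA'; set ZB := (fun y : K => _) in HB'.
  have tk := t0 k.
  (* Four errors, each at most eps/4: the linearisation remainder [X] and the residual [Y], both
     relative to [t k], and the images [ZA], [ZB] of the direction errors. *)
  have -> : edist (d k) (dirder wl hl) = enorm (fun y => / t k * (X y - Y y) + (ZA y + ZB y)).
    apply: enorm_ext => y; rewrite /d /X /Y /ZA /ZB !edot_subr /dirder /w /h !edot_scalr.
    by rewrite !edot_subr; lra.
  apply: Rle_lt_trans (enorm_add _ _) _; rewrite enorm_scal Rabs_pos_eq; last first.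
    exact/Rlt_le/Rinv_0_lt_compat.
  have := enorm_add ZA ZB; have := enorm_sub X Y => HXY HZ.
  have : / t k * enorm (fun i => X i - Y i) <= / t k * ((eps / 4 + / (INR k + 1)) * t k).
    by apply: Rmult_le_compat_l; [exact/Rlt_le/Rinv_0_lt_compat|nra].
  have -> : / t k * ((eps / 4 + / (INR k + 1)) * t k) = eps / 4 + / (INR k + 1).
    by rewrite Rmult_comm Rmult_assoc Rinv_r; lra.
  nra.
have td : etangent C (g pb qb) (dirder wl hl).
  exists (fun k => t (s k)), (fun k => d (s k)); split=> //; split=> // k.
  by rewrite dE; case: (Hf (s k)).
have nd : ednormal C (g pb qb) (dirder wl hl) vl.
  exists (fun k => t (s k)), (fun k => d (s k)), (fun k => v (s k)).
  do 3!split=> //; move=> k; rewrite dE.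
  by case: (Hf (s k)) => _ Cc _ [Hpos _ Hmin _]; exact: proximal_normal.
have v0 := regular whnz tw td nd.
have {v0}v0 : forall y, vl y = 0.
  apply: v0 => h'.
  (* Only the inequality of [fermat] passes to the limit; applying it to [h'] and [- h'] gives
     orthogonality. *)
  have ge a : 0 <= edot vl (fun k => edot (B k) a).
    apply: Rnot_lt_le => Hneg; set b := fun k => edot (B k) a; set r := edot vl b in Hneg *.
    have r3 : 0 < - r / 3 by lra.
    have [e [e0 He]] := small_mult r3 (enorm_ge0 a).
    have [e' [e'0 He']] := small_mult r3 (enorm_ge0 b).
    have [dl [dl0 Hdl]] := fermat e0.
    have [k] := ev_ex (ev_and (ev_and (cv_ev ceta e0) (cv_ev ct dl0)) (econv_ev cv e'0)).
    move: (s k) => {}k [[]].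
    rewrite !Rminus_0_r !Rabs_pos_eq; [|exact: Rlt_le..].
    move=> Heta Ht Hv.
    have := Hdl _ _ _ _ (inv_pos k) (Hf k) Ht a; rewrite -/(v k) -/b.
    have {Hv}Hv := He' _ (conj (edist_ge0 _ _) (Rlt_le _ _ Hv)).
    have := He _ (conj (Rlt_le _ _ (inv_pos k)) (Rlt_le _ _ Heta)).
    have := He e (conj (Rlt_le _ _ e0) (Rle_refl _)).
    have := edot_le (fun y => v k y - vl y) b.
    rewrite -/(edist (v k) vl) edotC edot_subr !(edotC b) -/r; nra.
  have := ge (fun j => -1 * h' j).
  have -> : (fun k => edot (B k) (fun j => -1 * h' j)) = (fun k => -1 * edot (B k) h').
    by apply: functional_extensionality => k; exact: edot_scalr.
  rewrite edot_scalr; have := ge h'; lra.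
have half : 0 < 1 / 2 by lra.
have [k] := ev_ex (cv_ev (limnz _ _ _ cv v0) half).
rewrite !Rminus_0_r !Rabs_pos_eq; try exact: enorm_ge0.
by have := nv (s k); lra.
Qed.

Lemma lipschitz : exists L delta, 0 <= L /\ 0 < delta /\
  forall p p' q q', edist p pb < delta -> edist p' pb < delta ->
    edist q qb < delta -> edist q' qb < delta ->
    edist (g p' q') (g p q) <= L * (edist p' p + edist q' q).
Proof.
have [MA [MA0 HA]] := matrix_bound A; have [MB [MB0 HB]] := matrix_bound B.
have [delta [d0 Hd]] := gdiff Rlt_0_1.
exists (1 + MA + MB), delta; split; first lra; split=> // p p' q q' Hp Hp' Hq Hq'.
have := Hd _ _ _ _ Hp Hp' Hq Hq'; set X := (fun k : K => _).
have := HA (fun i => p' i - p i); have := HB (fun j => q' j - q j).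
set ZA := (fun k : K => _); set ZB := (fun k : K => _).
rewrite -/(edist _ _) -/(edist _ _) => H1 H2 H3.
have -> : edist (g p' q') (g p q) = enorm (fun k => X k + (ZB k + ZA k)).
  by apply: enorm_ext => k; rewrite /X /ZA /ZB; lra.
apply: Rle_trans (enorm_add _ _) _; have := enorm_add ZA ZB.
have -> : enorm (fun k => ZA k + ZB k) = enorm (fun k => ZB k + ZA k).
  by apply: enorm_ext => k; lra.
have := edist_ge0 p' p; have := edist_ge0 q' q; nra.
Qed.

(** Minimising over [q] and [c] jointly gives a nearest point of [C] along with the minimiser, so no
    separate projection has to be constructed. [delta] confines the ball to the region where [g] is
    Lipschitz. *)
Lemma minimizer : exists delta, 0 < delta /\ forall eta p q0 c0 r,
  0 <= eta -> 0 <= r -> edist p pb < delta -> edist q0 qb + r < delta -> C c0 ->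
  exists q c, C c /\ edist q q0 <= r /\
    forall q' c', C c' -> edist q' q0 <= r ->
      edist (g p q) c + eta * edist q q0 <= edist (g p q') c' + eta * edist q' q0.
Proof.
have [L [delta [L0 [d0 HL]]]] := lipschitz; exists delta; split=> //.
move=> eta p q0 c0 r eta0 r0 Hp Hr Cc0.
pose D (x : (J -> R) * (K -> R)) := C x.2 /\ edist x.1 q0 <= r.
pose f (x : (J -> R) * (K -> R)) := edist (g p x.1) x.2 + eta * edist x.1 q0.
have [||m [Hm Happ]] := @approx_inf _ D f (q0, c0).
- by split=> //=; rewrite edist_refl.
- move=> x _; have := edist_ge0 (g p x.1) x.2; have := edist_ge0 x.1 q0.
  by rewrite /f; nra.
have inv_pos k : 0 < / (INR k + 1).
  by apply: Rinv_0_lt_compat; have := pos_INR k; lra.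
have Hex k := Happ _ (inv_pos k).
pose a k := proj1_sig (constructive_indefinite_description _ (Hex k)).
have Ha k : D (a k) /\ f (a k) < m + / (INR k + 1).
  by rewrite /a; case: constructive_indefinite_description.
move: a Ha => a Ha {Hex}.
have Hin q : edist q q0 <= r -> edist q qb < delta by have := edist_tri q0 q qb; lra.
have lip q q' : edist q q0 <= r -> edist q' q0 <= r ->
    edist (g p q') (g p q) <= L * edist q' q.
  by move=> Hq Hq'; have := HL p p q q' Hp Hp (Hin _ Hq) (Hin _ Hq'); rewrite edist_refl Rplus_0_l.
pose x k (s : J + K) := match s with inl j => (a k).1 j | inr y => (a k).2 y end.
have q0r : edist q0 q0 <= r by rewrite edist_refl.
(* The first two terms bound [q]. The rest bounds [c], which lies within m + 1 of g(p, q), itself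
   within L * r of g(p, q0). *)
have [] := @bolzano _ x (r + enorm q0 + (m + 1 + L * r + enorm (g p q0))).
  move=> k; have [[Cc Hq] Hf] := Ha k.
  have m1 : / (INR k + 1) <= 1.
    by rewrite -[X in _ <= X]Rinv_1; apply: Rinv_le_contravar; have := pos_INR k; lra.
  have Hq2 := edist_ge0 (a k).1 q0; have Hc2 := edist_ge0 (g p (a k).1) (a k).2.
  have l1 := lip _ _ q0r Hq.
  have n1 := enorm_ge0 q0; have n2 := enorm_ge0 (g p q0).
  have m0 : 0 <= m + 1 by rewrite /f in Hf; nra.
  have lr : 0 <= L * r by nra.
  have l2 : L * edist (a k).1 q0 <= L * r by nra.
  case=> [j|y] /=.
    have := coord_le (a k).1 j.
    have := enorm_add (fun j => (a k).1 j - q0 j) q0; rewrite -/(edist _ _).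
    rewrite (@enorm_ext _ _ (a k).1) => [|i]; lra.
  have := coord_le (a k).2 y.
  have -> : enorm (a k).2 = enorm (fun y => (g p (a k).1 y - g p q0 y) + g p q0 y - (g p (a k).1 y - (a k).2 y)).
    by apply: enorm_ext => i; lra.
  have := enorm_sub (fun y => (g p (a k).1 y - g p q0 y) + g p q0 y) (fun y => g p (a k).1 y - (a k).2 y).
  have := enorm_add (fun y => g p (a k).1 y - g p q0 y) (g p q0).
  rewrite -!/(edist _ _); rewrite /f in Hf; nra.
move=> s [l [Hs Hl]].
pose q j := l (inl j); pose c y := l (inr y).
have cq : econv (fun k => (a (s k)).1) q.
  by apply: coord_econv => j; exact: (econv_coord (inl j) Hl).
have cc : econv (fun k => (a (s k)).2) c.
  by apply: coord_econv => y; exact: (econv_coord (inr y) Hl).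
have Cc : C c by apply: Cclosed cc => k; case: (Ha (s k)) => [[]].
have qr : edist q q0 <= r.
  apply: le_epsilon => eps e0; have [k Hk] := ev_ex (econv_ev cq e0).
  have [[_ Hq] _] := Ha (s k).
  by have := edist_tri (a (s k)).1 q q0; rewrite (edist_sym q (a (s k)).1); lra.
exists q, c; split=> //; split=> // q' c' Cc' Hq'.
apply: Rle_trans (Hm (q', c') (conj Cc' Hq')).
(* The value at the limit exceeds the infimum by at most four errors: [L] and [eta] times the
   distance in [q], the distance in [c], and the excess of the minimising sequence. *)
apply: le_epsilon => eps e0; have e4 : 0 < eps / 4 by lra.
have [b [b0 Hb]] := small_mult e4 L0; have [b' [b'0 Hb']] := small_mult e4 eta0.
have ceta : Un_cv (fun k => / (INR k + 1)) 0.
  apply: ev_cv => e /inv_small; apply: ev_imp => k.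
  by rewrite Rminus_0_r Rabs_pos_eq //; apply: Rlt_le.
have [k [[H1 H2] [H3 H4]]] := ev_ex (ev_and (ev_and (econv_ev cq b0) (econv_ev cq b'0))
  (ev_and (econv_ev cc e4) (cv_ev (cv_sub Hs ceta) e4))).
rewrite Rminus_0_r Rabs_pos_eq in H4; last exact: Rlt_le.
have [[_ Hq] Hf] := Ha (s k).
have {}Hb := Hb _ (conj (edist_ge0 _ _) (Rlt_le _ _ H1)).
have {}Hb' := Hb' _ (conj (edist_ge0 _ _) (Rlt_le _ _ H2)).
have := lip _ _ Hq qr; rewrite (edist_sym q (a (s k)).1) => Hlip.
have := edist_tri (a (s k)).1 q q0; rewrite (edist_sym q (a (s k)).1) => T1.
have := edist_tri (g p (a (s k)).1) (g p q) c.
have := edist_tri (a (s k)).2 (g p (a (s k)).1) c.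
rewrite (edist_sym (g p q)) /f in Hf Hlip *; nra.
Qed.

(** Comparing the minimiser with [q0] bounds [eta * |q - q0|] by the initial residual. A positive
    final residual would make the minimiser stationary. Since its location is unknown, the size
    conditions of [stationary] are required on the whole ball. *)
Lemma descent eta : 0 < eta -> (forall p q c, ~ stationary eta p q c) ->
  exists delta, 0 < delta /\ forall p q0 c0 r, P p -> C c0 -> 0 < r ->
  edist p pb < delta -> edist q0 qb + r < delta ->
  edist (g p q0) c0 < eta * r ->
  (forall q, edist q q0 <= r -> edist p pb + edist q qb < eta /\
     edist (g p q0) c0 <= eta * (edist p pb + edist q qb)) ->
  exists q, C (g p q) /\ edist q0 q <= / eta * edist (g p q0) c0.
Proof.
move=> eta0 Hno; have [delta [d0 Hmin]] := minimizer; exists delta; split=> //.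
move=> p q0 c0 r Pp Cc0 r0 Hp Hq Hr Hball.
have [q [c [Cc [qr Hqc]]]] := Hmin eta p q0 c0 r (Rlt_le _ _ eta0) (Rlt_le _ _ r0) Hp Hq Cc0.
have q0r : edist q0 q0 <= r by rewrite edist_refl; lra.
have := Hqc q0 c0 Cc0 q0r; rewrite edist_refl Rmult_0_r Rplus_0_r => Hle.
have E0 := edist_ge0 (g p q) c; have Q0 := edist_ge0 q q0.
have Hqe : edist q q0 <= / eta * edist (g p q0) c0.
  apply: (Rmult_le_reg_l eta) => //; rewrite -Rmult_assoc Rinv_r; last lra.
  lra.
case: (Req_dec (edist (g p q) c) 0) => [/edist_eq0 Hc|Ene].
  by exists q; split; [rewrite Hc|rewrite edist_sym].
have [Hb1 Hb2] := Hball q qr.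
case: (Hno p q c); split=> //; split.
- lra.
- nra.
- by move=> c' Cc'; have := Hqc q c' Cc' qr; lra.
(* The strict bound on the initial residual makes [q] interior, which leaves room for the local
   minimality ball; there the triangle inequality recentres the penalty from [q0] to [q]. *)
have qr' : edist q q0 < r by apply: (Rmult_lt_reg_l eta) => //; lra.
exists (r - edist q q0); split=> [|q' Hq']; first lra.
have tri := edist_tri q q' q0.
have q'r : edist q' q0 <= r by lra.
have := Hqc q' c Cc q'r; nra.
Qed.

Hypothesis base : C (g pb qb).
(** More than tangency: the straight segment stays in [C], so the linear prediction itself supplies
    a point of [C] to compare with. *)
Hypothesis feasible : forall w, etangent P pb w ->
  exists h tau, 0 < tau /\ forall t, 0 < t < tau ->
    C (fun k => g pb qb k + t * dirder w h k).

(** The correction [h] depends on the direction [w] with no uniform bound at hand. [L] therefore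
    comes from compactness: violations with constants [k] tending to infinity have a limit
    direction, and the single [h] of that direction already refutes them. *)
Lemma nearby_solution : exists L delta, 0 <= L /\ 0 < delta /\
  forall p, P p -> edist p pb < delta ->
    exists q, C (g p q) /\ edist q qb <= L * edist p pb.
Proof.
have [eta [eta0 Hno]] := no_stationary; have [dl [dl0 Hdesc]] := descent eta0 Hno.
apply: NNPP => Hn.
have inv_pos k : 0 < / (INR k + 1).
  by apply: Rinv_0_lt_compat; have := pos_INR k; lra.
have Hex k : exists p, P p /\ edist p pb < / (INR k + 1) /\
    forall q, C (g p q) -> INR k * edist p pb < edist q qb.
  apply: NNPP => Hk; apply: Hn; exists (INR k), (/ (INR k + 1)).
  split; first exact: pos_INR; split=> // p Pp Hp; apply: NNPP => Hq.
  apply: Hk; exists p; do 2!split=> //; move=> q Cq; apply: Rnot_le_lt => Hle.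
  by apply: Hq; exists q.
pose p k := proj1_sig (constructive_indefinite_description _ (Hex k)).
have Hp k : P (p k) /\ edist (p k) pb < / (INR k + 1) /\
    forall q, C (g (p k) q) -> INR k * edist (p k) pb < edist q qb.
  by rewrite /p; case: constructive_indefinite_description.
move: p Hp => p Hp {Hex Hn}.
pose t k := edist (p k) pb.
(* At [pb] itself [qb] is a solution at distance 0, so a violating parameter differs from [pb]. *)
have t0 k : 0 < t k.
  have [_ [_ H]] := Hp k; case: (edist_ge0 (p k) pb) => // Hz.
  move: H; rewrite -Hz (edist_eq0 (esym Hz)) => /(_ qb base).
  by rewrite edist_refl; lra.
pose w k i := / t k * (p k i - pb i).
have nw k : enorm (w k) = 1.
  rewrite /w enorm_scal Rabs_pos_eq; last by apply/Rlt_le/Rinv_0_lt_compat.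
  by rewrite Rinv_l //; have := t0 k; rewrite /t; lra.
have [k i|s [wl [Hs cw]]] := @bolzano _ w 1; first by rewrite -(nw k); exact: coord_le.
have ct : Un_cv (fun k => t (s k)) 0.
  apply: (@cv_sub t) => //; apply: ev_cv => e /inv_small; apply: ev_imp => k.
  rewrite Rminus_0_r Rabs_pos_eq; last exact: Rlt_le.
  by have [_ [H _]] := Hp k; rewrite /t; lra.
have tw : etangent P pb wl.
  exists (fun k => t (s k)), (fun k => w (s k)); split; first by split.
  split=> // k.
  have -> : (fun i => pb i + t (s k) * w (s k) i) = p (s k).
    apply: functional_extensionality => i; rewrite /w; field.
    by have := t0 (s k); lra.
  by case: (Hp (s k)).
have [h [tau [tau0 Htau]]] := feasible tw.
have [MA [MA0 HA]] := matrix_bound A.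
have h0 := enorm_ge0 h.
(* The increment has size [t * (1 + enorm h)], so the linearisation costs [eta / 3 * t]. Replacing
   [w k] by its limit costs another third, and the total stays below [eta * t]. *)
have e0 : 0 < eta / 3 / (1 + enorm h) by apply: Rdiv_lt_0_compat; lra.
have [d1 [d10 Hd1]] := gdiff e0.
have eta3 : 0 < eta / 3 by lra.
have [a [a0 Ha]] := small_mult eta3 MA0.
have mpos : 0 < Rmin (Rmin tau d1) (Rmin dl eta) by do 3?apply: Rmin_glb_lt.
(* For [q1] within [t] of the prediction, |p - pb| + |q1 - qb| is at most t + (t |h| + t); hence the
   2. *)
have hb : 0 <= enorm h + 2 by lra.
have [b [b0 Hb]] := small_mult mpos hb.
(* The corrected point will lie within [(enorm h + 1) * t] of [qb], which contradicts the violation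
   as soon as the index reaches this number. *)
have [N HN] : exists N : nat, enorm h + 1 <= INR N.
  by have [N HN] := INR_unbounded (enorm h + 1); exists N; lra.
have bigN : ev (fun k => (N <= k)%coq_nat) by exists N.
have [k [[Hk1 Hk2] Hk3]] := ev_ex (ev_and (ev_and (cv_ev ct b0) (econv_ev cw a0)) bigN).
have {}Hk3 : enorm h + 1 <= INR (s k).
  by apply: Rle_trans HN _; apply: le_INR; have := Hs k; lia.
rewrite Rminus_0_r Rabs_pos_eq in Hk1; last exact: Rlt_le.
move: (s k) Hk1 Hk2 Hk3 => {}k Hk1 Hk2 Hk3.
have tk := t0 k.
have {}Hb := Hb _ (conj (Rlt_le _ _ tk) (Rlt_le _ _ Hk1)).
have {}Ha := Ha _ (conj (edist_ge0 _ _) (Rlt_le _ _ Hk2)).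
have := Rmin_l (Rmin tau d1) (Rmin dl eta); have := Rmin_r (Rmin tau d1) (Rmin dl eta).
have := Rmin_l tau d1; have := Rmin_r tau d1; have := Rmin_l dl eta; have := Rmin_r dl eta.
move=> m1 m2 m3 m4 m5 m6.
have th0 : 0 <= t k * enorm h by apply: Rmult_le_pos; lra.
pose q j := qb j + t k * h j; pose c y := g pb qb y + t k * dirder wl h y.
have nq : edist q qb = t k * enorm h.
  rewrite -[t k in RHS]Rabs_pos_eq -?enorm_scal; last lra.
  by apply: enorm_ext => j; rewrite /q; lra.
have Cc : C c by apply: Htau; lra.
have Eb : edist (g (p k) q) c < eta * t k.
  have Hpd : edist (p k) pb < d1 by rewrite -/(t k); nra.
  have Hqd : edist q qb < d1 by rewrite nq; nra.
  have Hdiff := Hd1 pb (p k) qb q; rewrite !edist_refl in Hdiff.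
  have {Hpd Hqd}Hdiff := Hdiff d10 Hpd d10 Hqd; rewrite -/(t k) nq in Hdiff.
  have HA' := HA (fun i => w k i - wl i); rewrite -/(edist _ _) in HA'.
  set X := (fun y : K => _) in Hdiff; set Z := (fun y : K => _) in HA'.
  have -> : edist (g (p k) q) c = enorm (fun y => X y + t k * Z y).
    apply: enorm_ext => y; rewrite /X /Z /c /dirder /w.
    have -> : (fun j => q j - qb j) = (fun j => t k * h j).
      by apply: functional_extensionality => j; rewrite /q; lra.
    by rewrite !edot_subr !edot_scalr edot_subr; field; lra.
  apply: Rle_lt_trans (enorm_add _ _) _; rewrite enorm_scal Rabs_pos_eq; last lra.
  have : eta / 3 / (1 + enorm h) * (t k + t k * enorm h) = eta / 3 * t k by field; lra.
  nra.
have [|||||||q' [Cq' Hq']] := Hdesc (p k) q c (t k).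
- by case: (Hp k).
- exact: Cc.
- exact: tk.
- by rewrite -/(t k); nra.
- by rewrite nq; nra.
- exact: Eb.
- move=> q1 Hq1; rewrite -/(t k); have := edist_tri q q1 qb; have := edist_ge0 q1 qb.
  by rewrite nq; nra.
have [_ [_ Hfar]] := Hp k; have {}Hfar := Hfar _ Cq'; rewrite -/(t k) in Hfar.
have : edist q q' < t k.
  apply: Rle_lt_trans Hq' _; apply: (Rmult_lt_reg_l eta) => //.
  by rewrite -Rmult_assoc Rinv_r; lra.
have := edist_tri q q' qb; rewrite nq (edist_sym q' q); nra.
Qed.

(** The estimate is stated against every [c] in [C], which encodes the distance to [C] without an
    infimum. *)
Theorem robinson_stability : exists kappa delta, 0 <= kappa /\ 0 < delta /\
  forall p q c, P p -> edist p pb < delta -> edist q qb < delta -> C c ->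
    exists q', C (g p q') /\ edist q q' <= kappa * edist (g p q) c.
Proof.
have [eta [eta0 Hno]] := no_stationary; have [d1 [d10 Hdesc]] := descent eta0 Hno.
have [L [d2 [L0 [d20 Hnear]]]] := nearby_solution.
(* With t < 2d and a ball of radius t/2 < d, the ball stays within 2d of [qb], and the total
   distance to the base point stays below 3d. *)
have [d [d0 [Hd1 [Hd2 Hd3]]]] : exists d, 0 < d /\ 3 * d <= d1 /\ d <= d2 /\ 4 * d <= eta.
  exists (Rmin (Rmin (d1 / 3) d2) (eta / 4)).
  have := Rmin_l (Rmin (d1 / 3) d2) (eta / 4); have := Rmin_r (Rmin (d1 / 3) d2) (eta / 4).
  have := Rmin_l (d1 / 3) d2; have := Rmin_r (d1 / 3) d2; move=> *.
  by split; [do 2?apply: Rmin_glb_lt; lra|lra].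
have ie : 0 < / eta by apply: Rinv_0_lt_compat.
(* One constant for both cases: descent costs 1/eta, the detour near the base point 2(1 + L)/eta. *)
exists ((3 + 2 * L) * / eta), d; split; first nra; split=> // p q c Pp Hp Hq Cc.
set E := edist (g p q) c; set t := edist p pb + edist q qb.
have E0 : 0 <= E := edist_ge0 _ _.
have p0 := edist_ge0 p pb; have q0 := edist_ge0 q qb.
case: (Rlt_le_dec E (eta * (t / 2))) => HE.
  (* Points within t/2 of [q] remain at distance at least t/2 from the base point, so the residual
     is small relative to that distance on the whole ball. *)
  have [|||||||q' [Cq' Hq']] := Hdesc p q c (t / 2) => //.
  - by nra.
  - lra.
  - by rewrite /t; lra.
  - move=> q1 Hq1; have := edist_tri q1 q qb; have := edist_tri q q1 qb.
    rewrite (edist_sym q q1) -/E => T1 T2.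
    have Ht : t / 2 <= edist p pb + edist q1 qb by rewrite /t in Hq1 *; lra.
    by split; [rewrite /t in Hq1; lra|nra].
  exists q'; split=> //; apply: Rle_trans Hq' _; rewrite -/E.
  by have : 0 <= / eta * E; nra.
have [|q' [Cq' Hq']] := Hnear p Pp; first lra.
exists q'; split=> //.
have tE : t <= 2 * (/ eta * E).
  apply: (Rmult_le_reg_l eta) => //.
  have -> : eta * (2 * (/ eta * E)) = 2 * E by field; lra.
  lra.
have := edist_tri qb q q'; rewrite (edist_sym qb).
have : L * edist p pb <= L * t by rewrite /t; nra.
have : L * t <= L * (2 * (/ eta * E)) by nra.
rewrite /t in tE *; nra.
Qed.

(** A solution for [p], inserted at [p'], has residual at most [L * |p' - p|] with respect to its
    own value [g p q] in [C]; Robinson stability at [p'] corrects it. *)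
Theorem lipschitz_like : exists ell delta, 0 <= ell /\ 0 < delta /\
  forall p p' q, P p' -> edist p pb < delta -> edist p' pb < delta ->
    edist q qb < delta -> C (g p q) ->
    exists q', C (g p' q') /\ edist q q' <= ell * edist p p'.
Proof.
have [kappa [d1 [kappa0 [d10 HR]]]] := robinson_stability.
have [L [d2 [L0 [d20 HL]]]] := lipschitz.
exists (kappa * L), (Rmin d1 d2); split; first nra; split; first exact: Rmin_glb_lt.
have := Rmin_l d1 d2; have := Rmin_r d1 d2; move=> m1 m2 p p' q Pp' Hp Hp' Hq Cc.
have [||q' [Cq' Hq']] := HR p' q (g p q) Pp' _ _ Cc; [lra|lra|].
exists q'; split=> //; apply: Rle_trans Hq' _.
have := HL p p' q q; rewrite edist_refl (edist_sym p' p).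
by move=> /(_ ltac:(lra) ltac:(lra) ltac:(lra) ltac:(lra)); nra.
Qed.
End Robinson.

Lemma common_delta (I : finType) (Q : I -> R -> Prop) :
  (forall i, exists d, 0 < d /\ Q i d) ->
  (forall i d d', 0 < d' <= d -> Q i d -> Q i d') ->
  exists d, 0 < d /\ forall i, Q i d.
Proof.
move=> Hex Hmono.
suff [d [d0 Hd]] : exists d, 0 < d /\ forall i, i \in enum I -> Q i d.
  by exists d; split=> // i; apply: Hd; rewrite mem_enum.
elim: (enum I) => [|j s [d [d0 Hd]]]; first by exists 1; split; [lra|].
have [d' [d'0 Hd']] := Hex j.
have m0 : 0 < Rmin d d' by exact: Rmin_glb_lt.
exists (Rmin d d'); split=> // i; rewrite in_cons => /orP [/eqP ->|/Hd].
  by apply: Hmono Hd'; split=> //; exact: Rmin_r.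
by apply: Hmono; split=> //; exact: Rmin_l.
Qed.

Lemma abs_le x y : Rabs x <= y <-> - y <= x <= y.
Proof. by rewrite /Rabs; case: Rcase_abs => ?; lra. Qed.

(** * Calculus of strict gradients of scalar functions *)

Section Gradient.
Variables I J : finType.
Implicit Types (h : (I -> R) -> (J -> R) -> R) (a p : I -> R) (b q : J -> R).

Definition sgrad h p q a b : Prop := forall eps, 0 < eps -> exists delta, 0 < delta /\
  forall p1 p2 q1 q2, edist p1 p < delta -> edist p2 p < delta ->
    edist q1 q < delta -> edist q2 q < delta ->
    Rabs (h p2 q2 - h p1 q1 -
       (edot a (fun i => p2 i - p1 i) + edot b (fun j => q2 j - q1 j)))
      <= eps * (edist p2 p1 + edist q2 q1).

Lemma sgrad_ext h h' p q a a' b b' : (forall p q, h p q = h' p q) ->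
  (forall i, a i = a' i) -> (forall j, b j = b' j) ->
  sgrad h p q a b -> sgrad h' p q a' b'.
Proof.
move=> Hh /functional_extensionality <- /functional_extensionality <-.
have -> // : h = h'.
by apply: functional_extensionality => p'; apply: functional_extensionality => q'.
Qed.

Lemma edot_addl (L : finType) (u v w : L -> R) :
  edot (fun i => u i + v i) w = edot u w + edot v w.
Proof. by rewrite /edot -rsum_add; apply: eq_bigr => i _; lra. Qed.

Lemma sgrad_add h h' p q a a' b b' : sgrad h p q a b -> sgrad h' p q a' b' ->
  sgrad (fun p q => h p q + h' p q) p q (fun i => a i + a' i) (fun j => b j + b' j).
Proof.
move=> H H' eps e0; have e2 : 0 < eps / 2 by lra.
have [d [d0 Hd]] := H _ e2; have [d' [d'0 Hd']] := H' _ e2.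
exists (Rmin d d'); split; first exact: Rmin_glb_lt.
move=> p1 p2 q1 q2 Hp1 Hp2 Hq1 Hq2.
have m1 := Rmin_l d d'; have m2 := Rmin_r d d'.
have := Hd p1 p2 q1 q2 ltac:(lra) ltac:(lra) ltac:(lra) ltac:(lra).
have := Hd' p1 p2 q1 q2 ltac:(lra) ltac:(lra) ltac:(lra) ltac:(lra).
by rewrite !edot_addl !abs_le; lra.
Qed.

Lemma sgrad_scal t h p q a b : sgrad h p q a b ->
  sgrad (fun p q => t * h p q) p q (fun i => t * a i) (fun j => t * b j).
Proof.
move=> H eps e0; have t0 := Rabs_pos t.
have [d [d0 Hd]] := H (eps / (Rabs t + 1)) ltac:(apply: Rdiv_lt_0_compat; lra).
exists d; split=> // p1 p2 q1 q2 Hp1 Hp2 Hq1 Hq2.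
have {}Hd := Hd _ _ _ _ Hp1 Hp2 Hq1 Hq2.
rewrite !edot_scall -!Rmult_minus_distr_l -Rmult_plus_distr_l -Rmult_minus_distr_l Rabs_mult.
set s := edist p2 p1 + edist q2 q1 in Hd *.
have s0 : 0 <= s by apply: Rplus_le_le_0_compat; exact: edist_ge0.
apply: Rle_trans (Rmult_le_compat_l _ _ _ t0 Hd) _.
have -> : eps * s = (Rabs t + 1) * (eps / (Rabs t + 1) * s) by field; lra.
have : 0 < eps / (Rabs t + 1) by apply: Rdiv_lt_0_compat; lra.
nra.
Qed.

Lemma sgrad_cst c p q : sgrad (fun _ _ => c) p q (fun=> 0) (fun=> 0).
Proof.
move=> eps e0; exists 1; split=> [|p1 p2 q1 q2 _ _ _ _]; first lra.
rewrite !edot0l // (_ : _ - _ = 0); last lra.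
rewrite Rabs_R0; apply: Rmult_le_pos; first lra.
by apply: Rplus_le_le_0_compat; exact: edist_ge0.
Qed.

Lemma sgrad_sum (L : finType) (h : L -> (I -> R) -> (J -> R) -> R) p q
    (a : L -> I -> R) (b : L -> J -> R) :
  (forall y, sgrad (h y) p q (a y) (b y)) ->
  sgrad (fun p q => \big[Rplus/0]_y h y p q) p q
    (fun i => \big[Rplus/0]_y a y i) (fun j => \big[Rplus/0]_y b y j).
Proof.
move=> H; rewrite /index_enum; elim: (Finite.enum L) => [|y s IH].
  by apply: sgrad_ext (sgrad_cst 0 p q) => *; rewrite big_nil.
by apply: sgrad_ext (sgrad_add (H y) IH) => *; rewrite big_cons.
Qed.

Lemma sgrad_coord p q j0 :
  sgrad (fun _ q => q j0) p q (fun=> 0) (fun j => if j == j0 then 1 else 0).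
Proof.
move=> eps e0; exists 1; split=> [|p1 p2 q1 q2 _ _ _ _]; first lra.
rewrite edot0l // /edot (@rsum_pick _ _ j0) => [|j /negbTE ->]; last lra.
rewrite eqxx (_ : _ - _ = 0); last lra.
rewrite Rabs_R0; apply: Rmult_le_pos; first lra.
by apply: Rplus_le_le_0_compat; exact: edist_ge0.
Qed.

Lemma sgrad_lip h p q a b : sgrad h p q a b -> exists L delta, 0 <= L /\ 0 < delta /\
  forall p1 p2 q1 q2, edist p1 p < delta -> edist p2 p < delta ->
    edist q1 q < delta -> edist q2 q < delta ->
    Rabs (h p2 q2 - h p1 q1) <= L * (edist p2 p1 + edist q2 q1).
Proof.
move=> /(_ 1 Rlt_0_1) [d [d0 Hd]].
have a0 := enorm_ge0 a; have b0 := enorm_ge0 b.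
exists (1 + enorm a + enorm b), d; split; first lra; split=> // p1 p2 q1 q2 H1 H2 H3 H4.
have := Hd _ _ _ _ H1 H2 H3 H4.
have := edot_abs a (fun i => p2 i - p1 i); have := edot_abs b (fun j => q2 j - q1 j).
rewrite -!/(edist _ _); set X := edot b _; set Y := edot a _ => HX HY.
have := Rabs_triang (h p2 q2 - h p1 q1 - (Y + X)) (Y + X); have := Rabs_triang Y X.
rewrite (_ : _ - _ + _ = h p2 q2 - h p1 q1); last lra.
have := edist_ge0 p2 p1; have := edist_ge0 q2 q1; nra.
Qed.

(* The second factor vanishes at the base point, so only its own gradient survives. *)
Lemma sgrad_mul_coord h p q a b j0 : sgrad h p q a b ->
  sgrad (fun p' q' => h p' q' * (q' j0 - q j0)) p q
    (fun=> 0) (fun j => if j == j0 then h p q else 0).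
Proof.
move=> /sgrad_lip [L [d [L0 [d0 HL]]]] eps e0.
have e4 : 0 < eps / 4 by lra.
have [s0 [s00 Hs]] := small_mult e4 L0.
exists (Rmin d s0); split=> [|p1 p2 q1 q2 Hp1 Hp2 Hq1 Hq2]; first exact: Rmin_glb_lt.
have m1 := Rmin_l d s0; have m2 := Rmin_r d s0.
rewrite edot0l // /edot (@rsum_pick _ _ j0) => [|j /negbTE ->]; last lra.
rewrite eqxx.
have pp : edist p p < d by rewrite edist_refl.
have qq : edist q q < d by rewrite edist_refl.
have := HL p p2 q q2 pp ltac:(lra) qq ltac:(lra).
have := HL p1 p2 q1 q2 ltac:(lra) ltac:(lra) ltac:(lra) ltac:(lra).
have c1 := coord_le (fun j => q1 j - q j) j0.
have c2 := coord_le (fun j => q2 j - q1 j) j0.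
rewrite -!/(edist _ _) /= in c1 c2.
set S := edist p2 p1 + edist q2 q1 => H1 H2.
have P1 := edist_ge0 p2 p1; have Q1 := edist_ge0 q2 q1.
have P2 := edist_ge0 p2 p; have Q2 := edist_ge0 q2 q; have Q3 := edist_ge0 q1 q.
have l1 := Hs (edist p2 p) ltac:(lra); have l2 := Hs (edist q2 q) ltac:(lra).
have l3 := Hs (edist q1 q) ltac:(lra).
have -> : h p2 q2 * (q2 j0 - q j0) - h p1 q1 * (q1 j0 - q j0) - (0 + h p q * (q2 j0 - q1 j0)) =
  (h p2 q2 - h p q) * (q2 j0 - q1 j0) + (h p2 q2 - h p1 q1) * (q1 j0 - q j0) by lra.
apply: Rle_trans (Rabs_triang _ _) _; rewrite !Rabs_mult.
have S0 : 0 <= S by rewrite /S; lra.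
have : Rabs (h p2 q2 - h p q) * Rabs (q2 j0 - q1 j0) <= (eps / 2) * S.
  by apply: Rmult_le_compat; try exact: Rabs_pos; rewrite /S; nra.
have : Rabs (h p2 q2 - h p1 q1) * Rabs (q1 j0 - q j0) <= (L * S) * edist q1 q.
  by apply: Rmult_le_compat; try exact: Rabs_pos.
nra.
Qed.

End Gradient.

Lemma edot_sum (I J : finType) (u v : I + J -> R) :
  edot u v = edot (fun i => u (inl i)) (fun i => v (inl i)) +
             edot (fun j => u (inr j)) (fun j => v (inr j)).
Proof. exact: big_sumType. Qed.

Lemma edist_inl (I J : finType) (u v : I + J -> R) :
  edist (fun i => u (inl i)) (fun i => v (inl i)) <= edist u v.
Proof.
apply: sqrt_le_1_alt; rewrite [X in _ <= X]edot_sum.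
have := edot_ge0 (fun j => u (inr j) - v (inr j)); lra.
Qed.

Lemma sgrad_inl (I J L : finType) (h : (I -> R) -> (J -> R) -> R) p (q : J + L -> R) a b :
  sgrad h p (fun j => q (inl j)) a b ->
  sgrad (fun p q => h p (fun j => q (inl j))) p q a
    (fun s => match s with inl j => b j | inr _ => 0 end).
Proof.
move=> H eps e0; have [d [d0 Hd]] := H _ e0; exists d; split=> // p1 p2 q1 q2 H1 H2 H3 H4.
rewrite (edot_sum (fun s => match s with inl j => b j | inr _ => 0 end)) /=.
rewrite (@edot0l _ (fun=> 0)) // Rplus_0_r.
apply: Rle_trans (Hd _ _ (fun j => q1 (inl j)) (fun j => q2 (inl j)) H1 H2 _ _) _.
- exact: Rle_lt_trans (edist_inl _ _) H3.
- exact: Rle_lt_trans (edist_inl _ _) H4.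
by have := edist_inl q2 q1; nra.
Qed.

Lemma dotE k (u v : vec k) : dot u v = edot u v.
Proof. by []. Qed.

Lemma norm2_ge (a b : nat) (u : vec a) (v : vec b) :
  0 <= norm2 u v /\ enorm u <= norm2 u v /\ enorm v <= norm2 u v.
Proof.
have := edot_ge0 u; have := edot_ge0 v => Hv Hu.
by split; [exact: sqrt_pos|split; apply: sqrt_le_1_alt; rewrite !dotE; lra].
Qed.

Lemma norm2_le (a b : nat) (u : vec a) (v : vec b) : norm2 u v <= enorm u + enorm v.
Proof.
have Hu := enorm_ge0 u; have Hv := enorm_ge0 v.
apply: Rsqr_incr_0_var; last lra.
rewrite /Rsqr /norm2 sqrt_sqrt; last by apply: Rplus_le_le_0_compat; exact: edot_ge0.
rewrite !dotE -!enorm_sq; nra.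
Qed.

Lemma norm2_scal (a b : nat) t (u : vec a) (v : vec b) :
  norm2 (vscal t u) (vscal t v) = Rabs t * norm2 u v.
Proof.
rewrite /norm2 -sqrt_Rsqr_abs -sqrt_mult; [|exact: Rle_0_sqr|].
  by congr sqrt; rewrite !dotE /vscal !edot_scall !edot_scalr /Rsqr; lra.
by apply: Rplus_le_le_0_compat; exact: edot_ge0.
Qed.

(** * From continuous differentiability to strict gradients *)

Section C1.
Variables m n : nat.
Implicit Types (h : vec m -> vec n -> R) (p : vec m) (x : vec n).

Lemma sdiff_cont h p x gp gx : sdiff h p x gp gx ->
  forall eps, 0 < eps -> exists delta, 0 < delta /\ forall p' x',
    edist p' p < delta -> edist x' x < delta -> Rabs (h p' x' - h p x) < eps.
Proof.
move=> /(_ 1 Rlt_0_1) [d [d0 Hd]] eps e0.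
have [s [s0 Hs]] := @small_mult (eps / 2) (1 + enorm gp + enorm gx) ltac:(lra)
  ltac:(have := enorm_ge0 gp; have := enorm_ge0 gx; lra).
exists (Rmin (d / 2) (s / 2)); split=> [|p' x' Hp Hx]; first by apply: Rmin_glb_lt; lra.
have := Rmin_l (d / 2) (s / 2); have := Rmin_r (d / 2) (s / 2) => m1 m2.
pose dp := vsub p' p; pose dx := vsub x' x.
have [N0 [Np Nx]] := norm2_ge dp dx; have Nle := norm2_le dp dx.
have ep : enorm dp = edist p' p by []. have ex : enorm dx = edist x' x by [].
have := Hd dp dx ltac:(lra).
have -> : vadd p dp = p' by apply: functional_extensionality => i; rewrite /vadd /dp /vsub; lra.
have -> : vadd x dx = x' by apply: functional_extensionality => i; rewrite /vadd /dx /vsub; lra.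
have := edot_abs gp dp; have := edot_abs gx dx.
have := Hs (norm2 dp dx) ltac:(lra).
have g1 := enorm_ge0 gp; have g2 := enorm_ge0 gx.
have : enorm gp * enorm dp <= enorm gp * norm2 dp dx by nra.
have : enorm gx * enorm dx <= enorm gx * norm2 dp dx by nra.
rewrite !dotE !abs_le => A1 A2 A3 [A4 A5] [A6 A7] [A8 A9].
by apply: Rle_lt_trans (_ : eps / 2 < eps); [apply/abs_le; lra|lra].
Qed.

(** Both expansions are tested along the difference (dp, dx) of the gradients. With errors S/8 they
    give |dp|^2 + |dx|^2 <= S^2/4, whereas S^2 <= 2(|dp|^2 + |dx|^2) for S = |dp| + |dx|; hence S =
    0. *)
Lemma sdiff_unique h p x gp gx a b : sdiff h p x gp gx -> sgrad h p x a b ->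
  gp = a /\ gx = b.
Proof.
move=> H1 H2.
pose dp := vsub gp a; pose dx := vsub gx b; pose S := enorm dp + enorm dx.
have P0 := enorm_ge0 dp; have X0 := enorm_ge0 dx.
suff S0 : S = 0.
  rewrite /S in S0; split; apply: edist_eq0; rewrite /edist -/(vsub _ _);
  [rewrite -/dp|rewrite -/dx]; lra.
case: (Req_dec S 0) => // Sn0; exfalso; have Sp : 0 < S by rewrite /S in Sn0 *; lra.
have [d1 [d10 Hd1]] := H1 (S / 8) ltac:(lra); have [d2 [d20 Hd2]] := H2 (S / 8) ltac:(lra).
have [t [t0 Ht]] := @small_mult (Rmin d1 d2) S (Rmin_glb_lt _ _ _ d10 d20) ltac:(lra).
have {}Ht := Ht t ltac:(lra); have := Rmin_l d1 d2; have := Rmin_r d1 d2 => m1 m2.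
have Nle := norm2_le dp dx; have [N0 [Np Nx]] := norm2_ge dp dx.
have := Hd1 (vscal t dp) (vscal t dx); rewrite norm2_scal Rabs_pos_eq; last lra.
move=> /(_ ltac:(rewrite /S in Ht; nra)) A1.
have e1 : edist (vadd p (vscal t dp)) p = t * enorm dp.
  rewrite -[t in RHS]Rabs_pos_eq -?enorm_scal; last lra.
  by apply: enorm_ext => i; rewrite /vadd /vscal; lra.
have e2 : edist (vadd x (vscal t dx)) x = t * enorm dx.
  rewrite -[t in RHS]Rabs_pos_eq -?enorm_scal; last lra.
  by apply: enorm_ext => i; rewrite /vadd /vscal; lra.
have := Hd2 p (vadd p (vscal t dp)) x (vadd x (vscal t dx)).
rewrite !edist_refl e1 e2 => /(_ d20 ltac:(rewrite /S in Ht; nra) d20 ltac:(rewrite /S in Ht; nra)).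
have -> : (fun i => vadd p (vscal t dp) i - p i) = (fun i => t * dp i).
  by apply: functional_extensionality => i; rewrite /vadd /vscal; lra.
have -> : (fun i => vadd x (vscal t dx) i - x i) = (fun i => t * dx i).
  by apply: functional_extensionality => i; rewrite /vadd /vscal; lra.
have q1 : edot gp dp - edot a dp = enorm dp * enorm dp.
  by rewrite enorm_sq {3}/dp /vsub edotC -!(edotC dp) edot_subr.
have q2 : edot gx dx - edot b dx = enorm dx * enorm dx.
  by rewrite enorm_sq {3}/dx /vsub edotC -!(edotC dx) edot_subr.
move: A1; rewrite !dotE /vscal !edot_scalr !abs_le => [[A1 A2] [A3 A4]].
have A5 := Rmult_le_compat_l t _ _ (Rlt_le _ _ t0) Nle; rewrite -/S in A5.
have A6 : S / 8 * (t * norm2 dp dx) <= S / 8 * (t * S) by apply: Rmult_le_compat_l; lra.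
have A7 : t * enorm dp + t * enorm dx = t * S by rewrite /S; lra.
rewrite A7 in A3 A4.
have : t * (enorm dp * enorm dp + enorm dx * enorm dx) <= t * (S / 4 * S).
  by rewrite -q1 -q2; lra.
move=> /(Rmult_le_reg_l _ _ _ t0) A8.
have A9 : S * S <= 2 * (enorm dp * enorm dp + enorm dx * enorm dx).
  by rewrite /S; have := Rle_0_sqr (enorm dp - enorm dx); rewrite /Rsqr; lra.
by have := Rmult_lt_0_compat _ _ Sp Sp; lra.
Qed.

(** The mean value theorem on the segment joining the two points yields a gradient at an
    intermediate point; by convexity of balls this point is near the base, where gradients are
    within [eps]. *)
Lemma C1_sgrad h gp gx p x : (forall p x, sdiff h p x (gp p x) (gx p x)) ->
  (forall j eps, 0 < eps -> exists delta, 0 < delta /\ forall p' x',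
    edist p' p < delta -> edist x' x < delta -> Rabs (gp p' x' j - gp p x j) < eps) ->
  (forall j eps, 0 < eps -> exists delta, 0 < delta /\ forall p' x',
    edist p' p < delta -> edist x' x < delta -> Rabs (gx p' x' j - gx p x j) < eps) ->
  sgrad h p x (gp p x) (gx p x).
Proof.
move=> Hd Hp Hx eps e0.
have nm := pos_INR #|'I_m|; have nn := pos_INR #|'I_n|.
(* The denominator offsets the dimension factor of [enorm_bound]; the 1 covers dimension 0. *)
have em : 0 < eps / (INR #|'I_m| + 1) by apply: Rdiv_lt_0_compat; lra.
have en : 0 < eps / (INR #|'I_n| + 1) by apply: Rdiv_lt_0_compat; lra.
have [|d1 [d10 Hd1]] := common_delta (fun j => Hp j _ em).
  by move=> j d d' [d'0 d'd] H p' x' H1 H2; apply: H; lra.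
have [|d2 [d20 Hd2]] := common_delta (fun j => Hx j _ en).
  by move=> j d d' [d'0 d'd] H p' x' H1 H2; apply: H; lra.
exists (Rmin d1 d2); split=> [|p1 p2 x1 x2 P1 P2 X1 X2]; first exact: Rmin_glb_lt.
have m1 := Rmin_l d1 d2; have m2 := Rmin_r d1 d2.
pose dp := vsub p2 p1; pose dx := vsub x2 x1.
pose pp s := vadd p1 (vscal s dp); pose xx s := vadd x1 (vscal s dx).
pose f s := h (pp s) (xx s).
pose f' s := edot (gp (pp s) (xx s)) dp + edot (gx (pp s) (xx s)) dx.
have [N0 _] := norm2_ge dp dx.
have Hder s : derivable_pt_lim f s (f' s).
  move=> e e1.
  have [d [d0 Hds]] := Hd (pp s) (xx s) (e / 2 / (norm2 dp dx + 1))
    ltac:(apply: Rdiv_lt_0_compat; lra).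
  have dd : 0 < d / (norm2 dp dx + 1) by apply: Rdiv_lt_0_compat; lra.
  exists (mkposreal _ dd) => t t0 /= Ht.
  have tp := Rabs_pos_lt _ t0.
  have := Hds (vscal t dp) (vscal t dx); rewrite norm2_scal.
  have Htd : Rabs t * norm2 dp dx < d.
    have : Rabs t * (norm2 dp dx + 1) < d / (norm2 dp dx + 1) * (norm2 dp dx + 1).
      by apply: Rmult_lt_compat_r; lra.
    by rewrite /Rdiv Rmult_assoc Rinv_l; lra.
  move=> /(_ Htd).
  have -> : vadd (pp s) (vscal t dp) = pp (s + t).
    by apply: functional_extensionality => i; rewrite /pp /vadd /vscal; lra.
  have -> : vadd (xx s) (vscal t dx) = xx (s + t).
    by apply: functional_extensionality => i; rewrite /xx /vadd /vscal; lra.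
  rewrite !dotE /vscal !edot_scalr -/(f _) -/(f _) => Hb.
  have -> : (f (s + t) - f s) / t - f' s =
      / t * (f (s + t) - f s - t * edot (gp (pp s) (xx s)) dp - t * edot (gx (pp s) (xx s)) dx).
    by rewrite /f'; field.
  rewrite Rabs_mult Rabs_inv.
  apply: (Rmult_lt_reg_l (Rabs t)) => //.
  rewrite -Rmult_assoc Rinv_r; last lra.
  rewrite Rmult_1_l; apply: Rle_lt_trans Hb _.
  have -> : e / 2 / (norm2 dp dx + 1) * (Rabs t * norm2 dp dx) =
    Rabs t * (e / 2 * (1 - / (norm2 dp dx + 1))) by field; lra.
  have ip : 0 < / (norm2 dp dx + 1) by apply: Rinv_0_lt_compat; lra.
  by apply: Rmult_lt_compat_l => //; nra.
have [c [Hc c01]] := @MVT_cor2 f f' 0 1 Rlt_0_1 (fun s _ => Hder s).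
have f1 : f 1 = h p2 x2.
  rewrite /f; congr h; apply: functional_extensionality => i;
  by rewrite /pp /xx /vadd /vscal /dp /dx /vsub; lra.
have f0 : f 0 = h p1 x1.
  rewrite /f; congr h; apply: functional_extensionality => i;
  by rewrite /pp /xx /vadd /vscal; lra.
have convex (L : finType) (z z1 z2 zc : L -> R) d : edist z1 z < d -> edist z2 z < d ->
    (forall i, zc i = z1 i + c * (z2 i - z1 i)) -> edist zc z < d.
  move=> H1 H2 H3.
  have -> : edist zc z = enorm (fun i => (1 - c) * (z1 i - z i) + c * (z2 i - z i)).
    by apply: enorm_ext => i; rewrite H3; lra.
  apply: Rle_lt_trans (enorm_add _ _) _; rewrite !enorm_scal !Rabs_pos_eq; try lra.
  rewrite -!/(edist _ _); nra.
have Pc : edist (pp c) p < Rmin d1 d2 by apply: convex P1 P2 _.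
have Xc : edist (xx c) x < Rmin d1 d2 by apply: convex X1 X2 _.
have B1 : edist (gp (pp c) (xx c)) (gp p x) <= eps.
  apply: Rle_trans (@enorm_bound _ _ (eps / (INR #|'I_m| + 1)) _ _) _ => [|j|].
  - lra.
  - by apply: Rlt_le; apply: Hd1; lra.
  have -> : INR #|'I_m| * (eps / (INR #|'I_m| + 1)) = eps - eps / (INR #|'I_m| + 1).
    by field; lra.
  lra.
have B2 : edist (gx (pp c) (xx c)) (gx p x) <= eps.
  apply: Rle_trans (@enorm_bound _ _ (eps / (INR #|'I_n| + 1)) _ _) _ => [|j|].
  - lra.
  - by apply: Rlt_le; apply: Hd2; lra.
  have -> : INR #|'I_n| * (eps / (INR #|'I_n| + 1)) = eps - eps / (INR #|'I_n| + 1).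
    by field; lra.
  lra.
have D1 := edot_abs (fun i => gp (pp c) (xx c) i - gp p x i) dp.
have D2 := edot_abs (fun i => gx (pp c) (xx c) i - gx p x i) dx.
rewrite -/(edist _ _) edotC edot_subr !(edotC dp) in D1.
rewrite -/(edist _ _) edotC edot_subr !(edotC dx) in D2.
have p0 := enorm_ge0 dp; have x0 := enorm_ge0 dx.
have {}D1 := Rle_trans _ _ _ D1 (Rmult_le_compat_r _ _ _ p0 B1).
have {}D2 := Rle_trans _ _ _ D2 (Rmult_le_compat_r _ _ _ x0 B2).
rewrite -f1 -f0 Hc /f' -/(vsub p2 p1) -/(vsub x2 x1) -/dp -/dx.
have -> : edist p2 p1 = enorm dp by []. have -> : edist x2 x1 = enorm dx by [].
move: D1 D2; rewrite !abs_le; lra.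
Qed.

End C1.

(** * The complementarity set: feasible directions and normals *)

Lemma cv_ge0 u a : (forall k, 0 <= u k) -> Un_cv u a -> 0 <= a.
Proof.
move=> H Hu; apply: Rnot_lt_le => Ha.
have na : 0 < - a by lra.
have [k] := ev_ex (cv_ev Hu na).
by have := H k; rewrite /Rabs; case: Rcase_abs => ?; lra.
Qed.

Lemma cv_le0 u a : (forall k, u k <= 0) -> Un_cv u a -> a <= 0.
Proof.
move=> H Hu; apply: Rnot_lt_le => Ha.
have [k] := ev_ex (cv_ev Hu Ha).
by have := H k; rewrite /Rabs; case: Rcase_abs => ?; lra.
Qed.

Lemma cv_mul0 u v a b : (forall k, u k * v k = 0) -> Un_cv u a -> Un_cv v b -> a * b = 0.
Proof.
move=> H Hu Hv; apply: (UL_sequence (fun k => u k * v k)); first exact: CV_mult.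
move=> eps e0; exists O => k _; rewrite H /R_dist Rminus_0_r Rabs_R0; lra.
Qed.

Lemma cv_pert a (t u : nat -> R) b : Un_cv t 0 -> Un_cv u b ->
  Un_cv (fun k => a + t k * u k) a.
Proof.
move=> Ht Hu; rewrite -[X in Un_cv _ X](_ : a + 0 * b = a); last lra.
apply: CV_plus; last exact: CV_mult.
by move=> eps e0; exists O => k _; rewrite /R_dist Rminus_diag Rabs_R0; lra.
Qed.

(* The set is a finite union of convex polyhedra, so tangent directions are feasible. *)
Lemma gphN_tangent l (a y w v : vec l) : gphN a y -> tangent2 gphN a y w v ->
  exists tau, 0 < tau /\ forall t, 0 < t < tau -> gphN (vadd a (vscal t w)) (vadd y (vscal t v)).
Proof.
move=> Hay [t [wk [vk [[t0 ct] [cw [cv Hk]]]]]].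
suff [tau [tau0 Htau]] : exists tau, 0 < tau /\ forall i t, 0 < t < tau ->
    a i + t * w i <= 0 /\ 0 <= y i + t * v i /\ (a i + t * w i) * (y i + t * v i) = 0.
  by exists tau; split=> // s Hs i; exact: Htau.
apply: common_delta => [i|i d d' Hd H s Hs]; last by apply: H; lra.
have [ai [yi ayi]] := Hay i.
have cwi := econv_coord i (cw : econv wk w).
have cvi := econv_coord i (cv : econv vk v).
have Hki k : a i + t k * wk k i <= 0 /\ 0 <= y i + t k * vk k i /\
  (a i + t k * wk k i) * (y i + t k * vk k i) = 0 := Hk k i.
have zero (u : nat -> R) b : ev (fun k => t k * u k = 0) -> Un_cv u b -> b = 0.
  move=> Hu cu; case: (Req_dec b 0) => // b0; exfalso.
  have [k [Hk1 Hk2]] := ev_ex (ev_and Hu (cv_ev cu (Rabs_pos_lt _ b0))).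
  have uk : u k = 0 by have := t0 k; case: (Rmult_integral _ _ Hk1); lra.
  by move: Hk2; rewrite uk Rminus_0_l Rabs_Ropp; lra.
have small b z : 0 < b -> exists d, 0 < d /\ forall s, 0 < s < d -> Rabs (s * z) < b.
  move=> b0; have [d [d0 Hd]] := small_mult b0 (Rabs_pos z); exists d; split=> // s Hs.
  by rewrite Rabs_mult (Rabs_pos_eq s); [apply: Hd|]; lra.
(* If [a i < 0], the perturbed entry is eventually nonzero, so complementarity keeps the partner at
   0 and forces [v i = 0]. The case [y i > 0] is symmetric. *)
case: (Rle_lt_or_eq_dec _ _ ai) => [ai'|ai0].
  have y0 : y i = 0 by case: (Rmult_integral _ _ ayi); lra.
  have v0 : v i = 0.
    apply: (zero (fun k => vk k i)) cvi.
    apply: ev_imp (cv_ev (cv_pert (a i) ct cwi) (_ : 0 < - a i)) => [k|]; last lra.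
    have [_ [_ Hp]] := Hki k; move=> /Rabs_def2 Ha.
    by case: (Rmult_integral _ _ Hp); lra.
  have [d [d0 Hd]] := small (- a i) (w i) ltac:(lra).
  exists d; split=> // s /Hd /Rabs_def2 Hs; rewrite y0 v0; lra.
case: (Rle_lt_or_eq_dec _ _ yi) => [yi'|yi0].
  have w0 : w i = 0.
    apply: (zero (fun k => wk k i)) cwi.
    apply: ev_imp (cv_ev (cv_pert (y i) ct cvi) yi') => k.
    have [_ [_ Hp]] := Hki k; move=> /Rabs_def2 Ha.
    by case: (Rmult_integral _ _ Hp); lra.
  have [d [d0 Hd]] := small (y i) (v i) yi'.
  exists d; split=> // s /Hd /Rabs_def2 Hs; rewrite ai0 w0; lra.
(* Both entries vanish: the conditions on ([w i], [v i]) are invariant under positive scaling, so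
   every step length is allowed and 1 is arbitrary. *)
exists 1; split=> [|s Hs]; first lra.
have W0 : w i <= 0 by apply: cv_le0 cwi => k; have [H _] := Hki k; have := t0 k; nra.
have V0 : 0 <= v i by apply: cv_ge0 cvi => k; have [_ [H _]] := Hki k; have := t0 k; nra.
have WV : w i * v i = 0.
  apply: cv_mul0 cwi cvi => k; have [_ [_]] := Hki k; rewrite ai0 -yi0 !Rplus_0_l => H.
  by have := t0 k; case: (Rmult_integral _ _ H) => /Rmult_integral [] -> ?; lra.
rewrite ai0 -yi0; split; [nra|split; [nra|]].
by rewrite !Rplus_0_l (_ : s * w i * (s * v i) = s * s * (w i * v i)); [rewrite WV|]; lra.
Qed.

Definition kkt_set n l (c : 'I_n + ('I_l + 'I_l) -> R) : Prop :=
  (forall i, c (inl i) = 0) /\ gphN (fun i => c (inr (inl i))) (fun i => c (inr (inr i))).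

Lemma kkt_set_closed n l : eclosed (@kkt_set n l).
Proof.
move=> x c Hx cx; split=> [i|i].
  have ci := econv_coord (inl i) cx; apply: Rle_antisym.
    by apply: cv_le0 ci => k; have [-> _] := Hx k; lra.
  by apply: cv_ge0 ci => k; have [-> _] := Hx k; lra.
have ca := econv_coord (inr (inl i)) cx; have cy := econv_coord (inr (inr i)) cx.
split; first by apply: cv_le0 ca => k; have [_ /(_ i) []] := Hx k.
split; first by apply: cv_ge0 cy => k; have [_ /(_ i) [_ []]] := Hx k.
by apply: cv_mul0 ca cy => k; have [_ /(_ i) [_ []]] := Hx k.
Qed.

Lemma econv_comp (I J : finType) (f : J -> I) (x : nat -> I -> R) l :
  econv x l -> econv (fun k j => x k (f j)) (fun j => l (f j)).
Proof. by move=> H; apply: coord_econv => j; exact: econv_coord. Qed.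

Section KKTSet.
Variables n l : nat.
Notation IK := ('I_n + ('I_l + 'I_l))%type.
Notation fst_part c := (fun i : 'I_l => c (inr (inl i))).
Notation snd_part c := (fun i : 'I_l => c (inr (inr i))).
Implicit Types c d v : IK -> R.

Lemma kkt_set_tangent c d : kkt_set c -> etangent (@kkt_set n l) c d ->
  (forall i, d (inl i) = 0) /\
  tangent2 gphN (fst_part c) (snd_part c) (fst_part d) (snd_part d).
Proof.
move=> [c0 _] [t [dk [[t0 ct] [cd Hk]]]]; split=> [i|].
  have z k : dk k (inl i) = 0.
    have [/(_ i) H _] := Hk k; move: H; rewrite c0 Rplus_0_l => /Rmult_integral [] //.
    by have := t0 k; lra.
  apply: (UL_sequence _ _ _ (econv_coord (inl i) cd)) => eps e0; exists O => k _.
  by rewrite z /R_dist Rminus_0_r Rabs_R0; lra.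
exists t, (fun k => fst_part (dk k)), (fun k => snd_part (dk k)).
split; first by split.
split; first exact: (econv_comp (fun i => inr (inl i)) cd).
split; first exact: (econv_comp (fun i => inr (inr i)) cd).
by move=> k; have [_] := Hk k.
Qed.

(** Test points share the zero block of [c], so the first block of [v] drops out of the inner
    product and remains free: it becomes the multiplier [z]. *)
Lemma kkt_set_normal c v : enormal (@kkt_set n l) c v ->
  rnormal2 gphN (fst_part c) (snd_part c) (fst_part v) (snd_part v).
Proof.
move=> [[c0 Cc] Hn]; split=> // eps /Hn [d [d0 Hd]]; exists d; split=> // y1 y2 Hy Hlt.
pose y (s : IK) := match s with inl i => c (inl i) | inr (inl i) => y1 i | inr (inr i) => y2 i end.
have Ey : edist y c = norm2 (vsub y1 (fst_part c)) (vsub y2 (snd_part c)).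
  rewrite /edist /enorm edot_sum edot0l => [|i]; last by rewrite /y /=; lra.
  by rewrite edot_sum Rplus_0_l.
have := Hd y; rewrite Ey => /(_ (conj c0 Hy) Hlt).
rewrite edot_sum edotC edot0l => [|i]; last by rewrite /y /=; lra.
by rewrite edot_sum Rplus_0_l.
Qed.

Lemma kkt_set_dnormal c d v : ednormal (@kkt_set n l) c d v ->
  dnormal2 gphN (fst_part c) (snd_part c) (fst_part d) (snd_part d) (fst_part v) (snd_part v).
Proof.
move=> [t [dk [vk [pt [cd [cv Hk]]]]]].
exists t, (fun k => fst_part (dk k)), (fun k => snd_part (dk k)),
  (fun k => fst_part (vk k)), (fun k => snd_part (vk k)).
split=> //.
split; first exact: (econv_comp (fun i => inr (inl i)) cd).
split; first exact: (econv_comp (fun i => inr (inr i)) cd).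
split; first exact: (econv_comp (fun i => inr (inl i)) cv).
split; first exact: (econv_comp (fun i => inr (inr i)) cv).
by move=> k; have H := kkt_set_normal (Hk k); split=> //; case: H.
Qed.

End KKTSet.

Lemma strict_diff_coord (I J K : finType) pb qb g (A : K -> I -> R) (B : K -> J -> R) :
  (forall k, sgrad (fun p q => g p q k) pb qb (A k) (B k)) ->
  strict_diff pb qb g A B.
Proof.
move=> H eps e0; have nK := pos_INR #|K|.
have e1 : 0 < eps / (INR #|K| + 1) by apply: Rdiv_lt_0_compat; lra.
have [|d [d0 Hd]] := common_delta (fun k => H k _ e1).
  by move=> k d d' Hd Hk *; apply: Hk; lra.
exists d; split=> // p p' q q' P1 P2 Q1 Q2.
set s := edist p' p + edist q' q.
have s0 : 0 <= s by apply: Rplus_le_le_0_compat; exact: edist_ge0.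
apply: Rle_trans (@enorm_bound _ _ (eps / (INR #|K| + 1) * s) _ _) _ => [|k|].
- by apply: Rmult_le_pos; lra.
- exact: Hd.
have -> : INR #|K| * (eps / (INR #|K| + 1) * s) = eps * s - eps / (INR #|K| + 1) * s.
  by field; lra.
have : 0 <= eps / (INR #|K| + 1) * s by apply: Rmult_le_pos; lra.
lra.
Qed.

(** * The KKT map and its strict derivative at the base point *)

Section KKTSystem.
Variables m n l : nat.
Variables (F : vec m -> vec n -> vec n) (phi : vec m -> vec n -> vec l).
Variables (Jpphi : vec m -> vec n -> mat l m) (Jxphi : vec m -> vec n -> mat l n).
Variables (JpG : mat n m) (JxG : mat n n) (pb : vec m) (xb : vec n) (yb : vec l).
Notation IJ := ('I_n + 'I_l)%type.
Notation IK := ('I_n + ('I_l + 'I_l))%type.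

Definition pair_vec (x : vec n) (y : vec l) (s : IJ) : R :=
  match s with inl j => x j | inr i => y i end.

Definition lagr p x (y : vec l) : vec n := vadd (F p x) (mtv (Jxphi p x) y).

Definition kkt_map (p : vec m) (q : IJ -> R) (s : IK) : R :=
  match s with
  | inl i => lagr p (fun j => q (inl j)) (fun j => q (inr j)) i
  | inr (inl i) => phi p (fun j => q (inl j)) i
  | inr (inr i) => q (inr i)
  end.

Definition kkt_p (s : IK) : vec m :=
  match s with inl i => JpG i | inr (inl i) => Jpphi pb xb i | inr (inr _) => fun=> 0 end.

(** In the [G] block the derivative in y is the transpose of [Jxphi], hence the exchanged
    indices. *)
Definition kkt_q (s : IK) : IJ -> R :=
  match s with
  | inl i => pair_vec (JxG i) (fun j => Jxphi pb xb j i)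
  | inr (inl i) => pair_vec (Jxphi pb xb i) (fun=> 0)
  | inr (inr i) => pair_vec (fun=> 0) (fun j => if j == i then 1 else 0)
  end.

Lemma C1s_sgrad (h : vec m -> vec n -> R) p x : C1s h -> exists a b, sgrad h p x a b.
Proof.
move=> [gp [gx [Hd [Hp Hx]]]]; exists (gp p x), (gx p x); apply: C1_sgrad => // j eps e0.
- have [d [d0 H]] := Hp j p x eps e0; exists (d / 2); split=> [|p' x' H1 H2]; first lra.
  by apply: H; apply: Rle_lt_trans (norm2_le _ _) _; rewrite -!/(edist _ _); lra.
- have [d [d0 H]] := Hx j p x eps e0; exists (d / 2); split=> [|p' x' H1 H2]; first lra.
  by apply: H; apply: Rle_lt_trans (norm2_le _ _) _; rewrite -!/(edist _ _); lra.
Qed.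

Lemma C1s_cont (h : vec m -> vec n -> R) p x : C1s h ->
  forall eps, 0 < eps -> exists delta, 0 < delta /\ forall p' x',
    edist p' p < delta -> edist x' x < delta -> Rabs (h p' x' - h p x) < eps.
Proof. by move=> [gp [gx [Hd _]]]; exact: sdiff_cont (Hd p x). Qed.

Hypothesis F_C1 : forall i, C1s (fun p x => F p x i).
Hypothesis phi_diff :
  forall i p x, sdiff (fun p x => phi p x i) p x (Jpphi p x i) (Jxphi p x i).
Hypothesis Jp_C1 : forall i j, C1s (fun p x => Jpphi p x i j).
Hypothesis Jx_C1 : forall i j, C1s (fun p x => Jxphi p x i j).
Hypothesis G_diff : forall i, sdiff (fun p x => lagr p x yb i) pb xb (JpG i) (JxG i).

(** The C1 hypotheses provide some strict gradient; uniqueness identifies it with the prescribed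
    [JpG i], [JxG i]. *)
Lemma lagr_sgrad i : sgrad (fun p x => lagr p x yb i) pb xb (JpG i) (JxG i).
Proof.
have [aF [bF HF]] := C1s_sgrad pb xb (F_C1 i).
pose a j := proj1_sig (constructive_indefinite_description _ (C1s_sgrad pb xb (Jx_C1 j i))).
have Ha j : exists b, sgrad (fun p x => Jxphi p x j i) pb xb (a j) b.
  by rewrite /a; case: constructive_indefinite_description.
pose b j := proj1_sig (constructive_indefinite_description _ (Ha j)).
have Hab j : sgrad (fun p x => Jxphi p x j i) pb xb (a j) (b j).
  by rewrite /b; case: constructive_indefinite_description.
have H := sgrad_add HF (sgrad_sum (fun j => sgrad_scal (yb j) (Hab j))).
have {}H := sgrad_ext (h' := fun p x => lagr p x yb i) _ (fun=> erefl) (fun=> erefl) H.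
have {}H := H ltac:(by move=> p q; congr Rplus; apply: eq_bigr => j _; lra).
by have [-> ->] := sdiff_unique (G_diff i) H.
Qed.

Lemma kkt_sgrad k :
  sgrad (fun p q => kkt_map p q k) pb (pair_vec xb yb) (kkt_p k) (kkt_q k).
Proof.
case: k => [i|[i|i]].
- have H1 : sgrad (fun p q => lagr p (fun j => q (inl j)) yb i) pb (pair_vec xb yb)
      (JpG i) (pair_vec (JxG i) (fun=> 0)).
    exact: (sgrad_inl (q := pair_vec xb yb) (lagr_sgrad i)).
  have H2 j : sgrad (fun p q => Jxphi p (fun j => q (inl j)) j i * (q (inr j) - yb j))
      pb (pair_vec xb yb) (fun=> 0) (fun s => if s == inr j then Jxphi pb xb j i else 0).
    have [a [b Hab]] := C1s_sgrad pb xb (Jx_C1 j i).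
    exact: (sgrad_mul_coord (inr j) (sgrad_inl (q := pair_vec xb yb) Hab)).
  (* G(p, x, y) is split as G(p, x, yb) plus the terms [Jxphi p x j i * (y j - yb j)], whose second
     factor vanishes at the base point. *)
  apply: sgrad_ext (sgrad_add H1 (sgrad_sum H2)) => [p q|j|[j|j]].
  + rewrite /= /lagr /vadd /mtv Rplus_assoc -rsum_add; congr Rplus.
    by apply: eq_bigr => j _; lra.
  + by rewrite big1 //=; lra.
  + by rewrite big1 //=; lra.
  + rewrite (@rsum_pick _ _ j) /= ?eqxx => [|j' /negbTE H]; first lra.
    by rewrite eq_sym; case: eqP => // -[] /eqP; rewrite H.
- apply: (sgrad_inl (q := pair_vec xb yb) (h := fun p x => phi p x i)).
  apply: (C1_sgrad (gp := fun p x => Jpphi p x i) (gx := fun p x => Jxphi p x i)) => // j.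
  + exact: C1s_cont.
  + exact: C1s_cont.
- apply: sgrad_ext (sgrad_coord pb (pair_vec xb yb) (inr i)) => // -[j|j] //=.
Qed.

Lemma edot_pair (x : vec n) (y : vec l) (h : IJ -> R) :
  edot (pair_vec x y) h = edot x (fun j => h (inl j)) + edot y (fun j => h (inr j)).
Proof. exact: edot_sum. Qed.

End KKTSystem.

(** * Transfer of the abstract result to the KKT system *)

Lemma edot_delta (I : finType) (u : I -> R) i : edot u (fun j => if j == i then 1 else 0) = u i.
Proof.
rewrite /edot (@rsum_pick _ _ i) ?eqxx => [|j /negbTE ->]; lra.
Qed.

Unset Implicit Arguments.

Theorem theorem5p2 (m n l : nat) (P : vec m -> Prop) (pb : vec m)
  (F : vec m -> vec n -> vec n) (phi : vec m -> vec n -> vec l)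
  (* partial Jacobians of phi: Jpphi p x i = grad_p phi_i, Jxphi p x i = grad_x phi_i *)
  (Jpphi : vec m -> vec n -> mat l m) (Jxphi : vec m -> vec n -> mat l n)
  (* partial Jacobians of G(.,.,yb) at (pb,xb) *)
  (JpG : mat n m) (JxG : mat n n)
  (xb : vec n) (yb : vec l) :
  let G := fun p x y => vadd (F p x) (mtv (Jxphi p x) y) in
  let Gamma := fun p x y => G p x y = vzero /\ gphN (phi p x) y in
  let Dphi := fun w u => vadd (mv (Jpphi pb xb) w) (mv (Jxphi pb xb) u) in
  let star := fun w u v =>
      vadd (vadd (mv JpG w) (mv JxG u)) (mtv (Jxphi pb xb) v) = vzero /\
      tangent2 gphN (phi pb xb) yb (Dphi w u) v in
  P pb ->
  (* F is C^1 *)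
  (forall i, C1s (fun p x => F p x i)) ->
  (* phi is C^2 *)
  (forall i p x, sdiff (fun p x => phi p x i) p x (Jpphi p x i) (Jxphi p x i)) ->
  (forall i j, C1s (fun p x => Jpphi p x i j)) ->
  (forall i j, C1s (fun p x => Jxphi p x i j)) ->
  (* JpG, JxG are the partial Jacobians of G at (pb,xb,yb) *)
  (forall i, sdiff (fun p x => G p x yb i) pb xb (JpG i) (JxG i)) ->
  Gamma pb xb yb ->
  (forall w, tangent P pb w -> exists u v, star w u v) ->
  (forall w u v, ~ (w = vzero /\ u = vzero /\ v = vzero) ->
     tangent P pb w -> star w u v ->
     forall (z : vec n) (lam d : vec l),
       vadd (mtv JxG z) (mtv (Jxphi pb xb) lam) = vzero ->
       vadd (mv (Jxphi pb xb) z) d = vzero ->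
       dnormal2 gphN (phi pb xb) yb (Dphi w u) v lam d ->
       z = vzero /\ lam = vzero) ->
  (* Robinson stability at (pb,(xb,yb)):
     dist((x,y);Gamma(p)) <= kappa * dist(g(p,x,y);C), written as
     "for all r >= dist(g(p,x,y);C), dist((x,y);Gamma(p)) <= kappa*r",
     with dist(z;S) <= r  unfolded as  forall eps>0, exists s in S, |z-s| <= r+eps *)
  (exists kappa delta, 0 <= kappa /\ 0 < delta /\
     forall p x y, P p -> vnorm (vsub p pb) < delta ->
       norm2 (vsub x xb) (vsub y yb) < delta ->
       forall r,
         (forall eps, 0 < eps -> exists a b, gphN a b /\
             norm3 (G p x y) (vsub (phi p x) a) (vsub y b) <= r + eps) ->
         (forall eps, 0 < eps -> exists x' y', Gamma p x' y' /\
             norm2 (vsub x x') (vsub y y') <= kappa * r + eps)) /\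
  (* Gamma is Lipschitz-like around (pb,(xb,yb)) *)
  (exists ell delta, 0 <= ell /\ 0 < delta /\
     forall p p', P p -> P p' -> vnorm (vsub p pb) < delta -> vnorm (vsub p' pb) < delta ->
       forall x y, Gamma p x y -> norm2 (vsub x xb) (vsub y yb) < delta ->
         exists x' y', Gamma p' x' y' /\
           norm2 (vsub x x') (vsub y y') <= ell * vnorm (vsub p p')).
Proof.
move=> G Gamma Dphi star Pb F_C1 phi_diff Jp_C1 Jx_C1 G_diff [Gb phib] Hfeas Hreg.
set qb := pair_vec xb yb.
set g := kkt_map F phi Jxphi; set C := @kkt_set n l.
set A := kkt_p Jpphi JpG pb xb; set B := kkt_q Jxphi JxG pb xb.
have gdiff : strict_diff pb qb g A B.
  by apply: strict_diff_coord; exact: kkt_sgrad.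
have Cb : C (g pb qb) by split=> // i; exact: (f_equal (fun f => f i) Gb).
have dirG w h i : dirder A B w h (inl i) =
    vadd (vadd (mv JpG w) (mv JxG (fun j => h (inl j)))) (mtv (Jxphi pb xb) (fun j => h (inr j))) i.
  by rewrite /dirder /B /= edot_pair -Rplus_assoc.
have dirphi w h : (fun i => dirder A B w h (inr (inl i))) = Dphi w (fun j => h (inl j)).
  apply: functional_extensionality => i.
  by rewrite /dirder /B /= edot_pair (edot0l (u := fun=> 0)) // Rplus_0_r.
have diry w h : (fun i => dirder A B w h (inr (inr i))) = (fun i => h (inr i)).
  apply: functional_extensionality => i.
  rewrite /dirder /B /= edot_pair !(edot0l (u := fun=> 0)) // !Rplus_0_l edotC.
  exact: (edot_delta (fun j => h (inr j))).
have feas w : etangent P pb w -> exists h tau, 0 < tau /\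
    forall t, 0 < t < tau -> C (fun k => g pb qb k + t * dirder A B w h k).
  move=> /Hfeas [u [v [star1 star2]]]; exists (pair_vec u v).
  have [tau [tau0 Htau]] := gphN_tangent phib star2.
  exists tau; split=> // t Ht; split=> [i|].
    rewrite dirG star1 /vzero Rmult_0_r Rplus_0_r.
    exact: (f_equal (fun f => f i) Gb).
  move=> i; have := Htau t Ht i.
  have := f_equal (fun f => f i) (dirphi w (pair_vec u v)).
  by have := f_equal (fun f => f i) (diry w (pair_vec u v)) => /= -> ->.
have reg w h : (exists i, w i <> 0) \/ (exists j, h j <> 0) -> etangent P pb w ->
    etangent C (g pb qb) (dirder A B w h) ->
    forall v, ednormal C (g pb qb) (dirder A B w h) v ->
    (forall h', edot v (fun k => edot (B k) h') = 0) -> forall k, v k = 0.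
  move=> nz tw td v nv Hv.
  have [d0 td2] := kkt_set_tangent Cb td; have nv2 := kkt_set_dnormal nv.
  rewrite dirphi diry in td2 nv2.
  have st : star w (fun j => h (inl j)) (fun j => h (inr j)).
    by split=> //; apply: functional_extensionality => i; rewrite -dirG d0.
  have nz' : ~ (w = vzero /\ (fun j => h (inl j)) = vzero /\ (fun j => h (inr j)) = vzero).
    move=> [w0 [u0 v0]]; case: nz => [[i]|[[j|j]]].
    - by rewrite w0.
    - by move: (f_equal (fun f => f j) u0) => /= ->.
    - by move: (f_equal (fun f => f j) v0) => /= ->.
  (* Testing orthogonality on unit vectors reads off the adjoint system: the x coordinates give
     [e1], the y coordinates give [e2]. *)
  have ev1 s : \big[Rplus/0]_i (v (inl i) * B (inl i) s) +
     (\big[Rplus/0]_i (v (inr (inl i)) * B (inr (inl i)) s) +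
      \big[Rplus/0]_i (v (inr (inr i)) * B (inr (inr i)) s)) = 0.
    have := Hv (fun s' => if s' == s then 1 else 0).
    have -> : (fun k => edot (B k) (fun s' => if s' == s then 1 else 0)) = (fun k => B k s).
      by apply: functional_extensionality => k; exact: edot_delta.
    by rewrite edot_sum edot_sum.
  have e1 : vadd (mtv JxG (fun i => v (inl i)))
      (mtv (Jxphi pb xb) (fun i => v (inr (inl i)))) = vzero.
    apply: functional_extensionality => j; have := ev1 (inl j).
    rewrite [X in _ + (_ + X)]big1 => [|i _] /=; last lra.
    move=> H; rewrite /vzero -H Rplus_0_r /vadd /mtv.
    by congr Rplus; apply: eq_bigr => i _; lra.
  have e2 : vadd (mv (Jxphi pb xb) (fun i => v (inl i))) (fun i => v (inr (inr i))) = vzero.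
    apply: functional_extensionality => j; have := ev1 (inr j).
    rewrite [X in _ + (X + _)]big1 => [|i _] /=; last lra.
    rewrite [X in _ + (_ + X)](@rsum_pick _ _ j) => [|i /negbTE H]; last first.
      by rewrite /= eq_sym H; lra.
    rewrite /= eqxx => H; rewrite /vzero -H Rplus_0_l Rmult_1_r /vadd /mv.
    by congr Rplus; apply: eq_bigr => i _; lra.
  have [z0 l0] := Hreg _ _ _ nz' tw st _ _ _ e1 e2 nv2.
  have zi i : v (inl i) = 0 := f_equal (fun f => f i) z0.
  case=> [i|[i|i]]; first exact: zi.
    exact: (f_equal (fun f => f i) l0).
  (* The hypothesis yields only [z] and [lam]; the last block equals [- Jxphi z] by [e2] and
     vanishes with [z]. *)
  move: (f_equal (fun f => f i) e2); rewrite /vadd /mv dotE edotC edot0l //.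
  by rewrite Rplus_0_l.
have dist_pair x y x' y' : edist (pair_vec x y) (pair_vec x' y') = norm2 (vsub x x') (vsub y y').
  by rewrite /edist /enorm edot_sum.
have Cgraph p x y : C (g p (pair_vec x y)) <-> Gamma p x y.
  split=> [[H1 H2]|[H1 H2]]; split=> //.
    exact: functional_extensionality.
  by move=> i; exact: (f_equal (fun f => f i) H1).
have unpair (q : 'I_n + 'I_l -> R) : q = pair_vec (fun j => q (inl j)) (fun j => q (inr j)).
  by apply: functional_extensionality => -[].
split.
  have [kappa [d [k0 [d0 HR]]]] := robinson_stability gdiff (@kkt_set_closed n l) reg Cb feas.
  exists kappa, d; do 2!split=> //; move=> p x y Pp Hp Hq r Hr eps e0.
  (* A point of [C] nearly realising the distance is chosen so that its slack, multiplied by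
     [kappa], stays below [eps]. *)
  have e1 : 0 < eps / (kappa + 1) by apply: Rdiv_lt_0_compat; lra.
  have [a [b [Hab Hn]]] := Hr _ e1.
  pose c (s : 'I_n + ('I_l + 'I_l)) :=
    match s with inl _ => 0 | inr (inl i) => a i | inr (inr i) => b i end.
  have Cc : C c by split.
  have Ec : edist (g p (pair_vec x y)) c = norm3 (G p x y) (vsub (phi p x) a) (vsub y b).
    rewrite /edist /enorm edot_sum edot_sum /norm3 Rplus_assoc.
    congr (sqrt (_ + _)); apply: eq_bigr => i _ /=; rewrite !Rminus_0_r //.
  have [|q' [Cq' Hq']] := HR p (pair_vec x y) c Pp Hp _ Cc; first by rewrite dist_pair.
  rewrite (unpair q') dist_pair Ec in Cq' Hq'.
  exists (fun j => q' (inl j)), (fun j => q' (inr j)); split; first exact/Cgraph.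
  apply: Rle_trans Hq' _; apply: Rle_trans (Rmult_le_compat_l _ _ _ k0 Hn) _.
  have : kappa * (eps / (kappa + 1)) = eps - eps / (kappa + 1) by field; lra.
  lra.
have [ell [d [l0 [d0 HL]]]] := lipschitz_like gdiff (@kkt_set_closed n l) reg Cb feas.
exists ell, d; do 2!split=> //; move=> p p' Pp Pp' Hp Hp' x y Hxy Hq.
have [||q' [Cq' Hq']] := HL p p' (pair_vec x y) Pp' Hp Hp'; first by rewrite dist_pair.
  exact/Cgraph.
rewrite (unpair q') dist_pair in Cq' Hq'.
by exists (fun j => q' (inl j)), (fun j => q' (inr j)); split; first exact/Cgraph.
Qed.
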